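(* Let $\mathsf{B}$ be the PROP for bialgebras. Every morphism $f\colon n\to m$ in $\mathsf{B}$ factors in a unique way as $$f=(\mu^{[q_1]}\otimes\cdots\otimes\mu^{[q_m]})\circ P_\sigma\circ(\Delta^{[p_1]}\otimes\cdots\otimes\Delta^{[p_n]})$$ for some (unique) integers $p_1,\dots,p_n,q_1,\dots,q_m\ge 0$ such that $\sum_i p_i=\sum_j q_j=:s$, and a (unique) permutation $\sigma\in\Sigma_s$.
   Context: A PROP is a (strict) symmetric monoidal category whose objects are the non-negative integers, with monoidal product $\otimes$ given on objects by the sum. $\mathsf{B}$ is the PROP freely generated by arrows $\mu\colon 2\to1$, $\eta\colon 0\to 1$, $\Delta\colon 1\to2$, $\varepsilon\colon1\to0$ subject to the bialgebra relations (where $P=P_{1,1}\colon 2\to 2$ is the symmetry): $\mu(\mu\otimes\mathrm{id})=\mu(\mathrm{id}\otimes\mu)$, $\mu(\mathrm{id}\otimes\eta)=\mathrm{id}=\mu(\eta\otimes\mathrm{id})$; $(\Delta\otimes\mathrm{id})\Delta=(\mathrm{id}\otimes\Delta)\Delta$, $(\mathrm{id}\otimes\varepsilon)\Delta=\mathrm{id}=(\varepsilon\otimes\mathrm{id})\Delta$; $\Delta\mu=(\mu\otimes\mu)(\mathrm{id}\otimes P\otimes\mathrm{id})(\Delta\otimes\Delta)$, $\Delta\eta=\eta\otimes\eta$, $\varepsilon\mu=\varepsilon\otimes\varepsilon$, $\varepsilon\eta=\mathrm{id}_0$. That is, morphisms are formal composites and monoidal products of the generators, identities and symmetry, modulo the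 smallest congruence (for $\circ$ and $\otimes$) containing the laws of strict symmetric monoidal categories and these relations. Iterated structure maps: $\mu^{[0]}=\eta$, $\mu^{[1]}=\mathrm{id}$, $\mu^{[k]}=\mu\circ(\mu^{[k-1]}\otimes\mathrm{id})$ for $k\ge2$; $\Delta^{[0]}=\varepsilon$, $\Delta^{[1]}=\mathrm{id}$, $\Delta^{[k]}=(\Delta^{[k-1]}\otimes\mathrm{id})\circ\Delta$ for $k\ge2$. Empty monoidal products are $\mathrm{id}_0$. $\Sigma_s$ is the symmetric group on $s$ letters ($\Sigma_0$ is the trivial group). For $\sigma\in\Sigma_s$, $P_\sigma\colon s\to s$ is determined by $P_{(i,i+1)}=\mathrm{id}^{\otimes(i-1)}\otimes P\otimes\mathrm{id}^{\otimes(s-i-1)}$ and the requirement that $\sigma\mapsto P_\sigma$ is a monoid homomorphism $\Sigma_s\to\mathrm{Hom}(s,s)$. *)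

(* Defs.v *)
From HB Require Import structures.
From mathcomp Require Import all_boot all_fingroup.
From mathcomp Require Import zify.

Set Implicit Arguments.
Unset Strict Implicit.
Unset Printing Implicit Defensive.

Declare Scope prop_scope.
Delimit Scope prop_scope with PROP.
Local Open Scope prop_scope.

(* Formal composites and monoidal products; the morphisms n -> m of the PROP
   of bialgebras are the terms of type [arrow n m] modulo [beq] below. *)
Inductive arrow : nat -> nat -> Type :=
| Id n : arrow n n
| Comp n m k : arrow m k -> arrow n m -> arrow n k
| Tens n m n' m' : arrow n m -> arrow n' m' -> arrow (n + n') (m + m')
| Symm n m : arrow (n + m) (m + n)
| Mu : arrow 2 1
| Eta : arrow 0 1
| Delta : arrow 1 2
| Eps : arrow 1 0.

Notation "g ∘ f" := (Comp g f) (at level 40, left associativity) : prop_scope.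
Notation "f ⊗ g" := (Tens f g) (at level 39, left associativity) : prop_scope.

(* Addition on nat is associative and right-unital only up to propositional
   equality, so strictness of the monoidal structure needs transport. *)
Definition cast n m n' m' (en : n = n') (em : m = m') (f : arrow n m) :
    arrow n' m' :=
  ecast k (arrow n' k) em (ecast k (arrow k m) en f).

Definition P11 : arrow 2 2 := Symm 1 1.

Reserved Notation "f ≡ g" (at level 70, no associativity).

Inductive beq : forall n m, arrow n m -> arrow n m -> Prop :=
| beq_refl n m (f : arrow n m) : f ≡ f
| beq_sym n m (f g : arrow n m) : f ≡ g -> g ≡ f
| beq_trans n m (f g h : arrow n m) : f ≡ g -> g ≡ h -> f ≡ h
| beq_comp n m k (g g' : arrow m k) (f f' : arrow n m) :
    g ≡ g' -> f ≡ f' -> g ∘ f ≡ g' ∘ f'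
| beq_tens n m n' m' (f g : arrow n m) (f' g' : arrow n' m') :
    f ≡ g -> f' ≡ g' -> f ⊗ f' ≡ g ⊗ g'
| comp_idl n m (f : arrow n m) : Id m ∘ f ≡ f
| comp_idr n m (f : arrow n m) : f ∘ Id n ≡ f
| comp_assoc n m k l (h : arrow k l) (g : arrow m k) (f : arrow n m) :
    h ∘ (g ∘ f) ≡ h ∘ g ∘ f
| tens_id n m : Id n ⊗ Id m ≡ Id (n + m)
| tens_interchange n m k n' m' k' (g : arrow m k) (f : arrow n m)
    (g' : arrow m' k') (f' : arrow n' m') :
    (g ⊗ g') ∘ (f ⊗ f') ≡ (g ∘ f) ⊗ (g' ∘ f')
| tens_assoc n m n' m' n'' m'' (f : arrow n m) (f' : arrow n' m')
    (f'' : arrow n'' m'') :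
    cast (addnA n n' n'') (addnA m m' m'') (f ⊗ (f' ⊗ f'')) ≡ f ⊗ f' ⊗ f''
| tens_unitl n m (f : arrow n m) : Id 0 ⊗ f ≡ f
| tens_unitr n m (f : arrow n m) : cast (addn0 n) (addn0 m) (f ⊗ Id 0) ≡ f
| sym_natural n m n' m' (f : arrow n m) (f' : arrow n' m') :
    Symm m m' ∘ (f ⊗ f') ≡ (f' ⊗ f) ∘ Symm n n'
| sym_invol n m : Symm m n ∘ Symm n m ≡ Id (n + m)
| sym_hexagon n m k :
    cast (addnA n m k) (esym (addnA m k n)) (Symm n (m + k)) ≡
    (Id m ⊗ Symm n k) ∘ cast erefl (esym (addnA m n k)) (Symm n m ⊗ Id k)
| mu_assoc : Mu ∘ (Mu ⊗ Id 1) ≡ Mu ∘ (Id 1 ⊗ Mu)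
| mu_unitr : Mu ∘ (Id 1 ⊗ Eta) ≡ Id 1
| mu_unitl : Mu ∘ (Eta ⊗ Id 1) ≡ Id 1
| delta_coassoc : (Delta ⊗ Id 1) ∘ Delta ≡ (Id 1 ⊗ Delta) ∘ Delta
| delta_counitr : (Id 1 ⊗ Eps) ∘ Delta ≡ Id 1
| delta_counitl : (Eps ⊗ Id 1) ∘ Delta ≡ Id 1
| delta_mu :
    Delta ∘ Mu ≡ (Mu ⊗ Mu) ∘ (Id 1 ⊗ P11 ⊗ Id 1) ∘ (Delta ⊗ Delta)
| delta_eta : Delta ∘ Eta ≡ Eta ⊗ Eta
| eps_mu : Eps ∘ Mu ≡ Eps ⊗ Eps
| eps_eta : Eps ∘ Eta ≡ Id 0
where "f ≡ g" := (beq f g) : prop_scope.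

Fixpoint mu_iter (k : nat) : arrow k 1 :=
  match k with
  | 0 => Eta
  | k'.+1 =>
    match k' return arrow k' 1 -> arrow k'.+1 1 with
    | 0 => fun=> Id 1
    | _ => fun mk' => cast (addn1 _) erefl (Mu ∘ (mk' ⊗ Id 1))
    end (mu_iter k')
  end.

Fixpoint delta_iter (k : nat) : arrow 1 k :=
  match k with
  | 0 => Eps
  | k'.+1 =>
    match k' return arrow 1 k' -> arrow 1 k'.+1 with
    | 0 => fun=> Id 1
    | _ => fun dk' => cast erefl (addn1 _) ((dk' ⊗ Id 1) ∘ Delta)
    end (delta_iter k')
  end.

Fixpoint mu_tens (q : seq nat) : arrow (sumn q) (size q) :=
  match q with
  | [::] => Id 0
  | k :: q' => mu_iter k ⊗ mu_tens q'
  end.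

Fixpoint delta_tens (p : seq nat) : arrow (size p) (sumn p) :=
  match p with
  | [::] => Id 0
  | k :: p' => delta_iter k ⊗ delta_tens p'
  end.

Section Adjacent.
Variable s : nat.
Implicit Type i : 'I_s.-1.

Fact adj_lt0 i : i < s. Proof. by case: i => i /=; lia. Qed.
Fact adj_lt1 i : i.+1 < s. Proof. by case: i => i /=; lia. Qed.
Fact adj_dim i : i + (2 + (s - i - 2)) = s.
Proof. by case: i => i /=; lia. Qed.

(* Letters are numbered from 0, so [i] swaps the positions i and i + 1. *)
Definition adj_perm i : 'S_s :=
  tperm (Ordinal (adj_lt0 i)) (Ordinal (adj_lt1 i)).

Definition adj_arrow i : arrow s s :=
  cast (adj_dim i) (adj_dim i) (Id i ⊗ (P11 ⊗ Id (s - i - 2))).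

(* The product of permutations is in diagrammatic order: (x * y) z = y (x z). *)
Definition word_perm (w : seq 'I_s.-1) : 'S_s := \prod_(i <- w) adj_perm i.

Fixpoint word_arrow (w : seq 'I_s.-1) : arrow s s :=
  match w with
  | [::] => Id s
  | i :: w' => word_arrow w' ∘ adj_arrow i
  end.

Let adj_generate_tperm (x y : 'I_s) : exists w, tperm x y == word_perm w.
Proof.
wlog le_xy : x y / x <= y.
  move=> H; case: (leqP x y) => [/H//|/ltnW/H[w]]; by exists w; rewrite tpermC.
move Dd : (y - x) => d; elim: d y le_xy Dd => [|d IHd] y le_xy Dd.
  have -> : y = x by apply/val_inj => /=; lia.
  by exists [::]; rewrite tperm1 /word_perm big_nil.
have lt_i : y.-1 < s.-1 by have := ltn_ord y; lia.
pose i := Ordinal lt_i.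
have Dy : Ordinal (adj_lt1 i) = y by apply/val_inj => /=; lia.
have [||w /eqP Dw] := IHd (Ordinal (adj_lt0 i)); rewrite /=; try lia.
case: d IHd Dd Dw => [|d] IHd Dd Dw.
  exists [:: i]; rewrite /word_perm big_seq1 /adj_perm Dy.
  by have <- : x = Ordinal (adj_lt0 i) by apply/val_inj => /=; lia.
exists (i :: rcons w i).
rewrite /word_perm big_cons big_rcons /= -/(word_perm w) -Dw.
have -> : (adj_perm i * (tperm x (Ordinal (adj_lt0 i)) * adj_perm i))%g
  = (tperm x (Ordinal (adj_lt0 i)) ^ adj_perm i)%g.
  by rewrite conjgE tpermV.
rewrite tpermJ /adj_perm tpermL Dy tpermD //; apply/eqP => /(congr1 val) /=; lia.
Qed.

Fact adj_generate (x : 'S_s) : exists w, x == word_perm w.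
Proof.
have [ts -> _] := prod_tpermP x; elim: ts => [|t ts [w /eqP Dw]].
  by exists [::]; rewrite /word_perm !big_nil.
have [v /eqP Dv] := adj_generate_tperm t.1 t.2.
by exists (v ++ w); rewrite big_cons Dw Dv /word_perm big_cat.
Qed.

(* Up to [beq] this does not depend on the word chosen: see [PermArrow.word_arrow_eq].
   The lemmas [perm_arrow1], [perm_arrowM], [perm_arrow_adj] and
   [perm_arrow_unique] of that module characterise [perm_arrow] as the monoid
   homomorphism determined by its values on adjacent transpositions. *)
Definition perm_arrow (x : 'S_s) : arrow s s :=
  word_arrow (xchoose (adj_generate x)).

End Adjacent.

Record factorization (n m : nat) := Factorization {
  fact_p : n.-tuple nat;
  fact_q : m.-tuple nat;
  fact_sum : sumn fact_p = sumn fact_q;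
  fact_perm : 'S_(sumn fact_p)
}.

Definition fact_arrow n m (d : factorization n m) : arrow n m :=
  cast (size_tuple (fact_p d)) (size_tuple (fact_q d))
    (mu_tens (fact_q d)
     ∘ cast erefl (fact_sum d) (perm_arrow (fact_perm d))
     ∘ delta_tens (fact_p d)).

Module PermArrow.

(* The Coxeter presentation of the symmetric group on {0, ..., n}; letter i
   is the transposition of i and i + 1. *)
Inductive cox (n : nat) : seq nat -> seq nat -> Prop :=
| cox_refl w : cox n w w
| cox_sym v w : cox n v w -> cox n w v
| cox_trans u v w : cox n u v -> cox n v w -> cox n u w
| cox_cat u u' v v' : cox n u u' -> cox n v v' -> cox n (u ++ v) (u' ++ v')
| cox_invol i : i < n -> cox n [:: i; i] [::]
| cox_braid i : i.+1 < n -> cox n [:: i; i.+1; i] [:: i.+1; i; i.+1]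
| cox_comm i j : i.+1 < j -> j < n -> cox n [:: i; j] [:: j; i].
#[local] Hint Resolve cox_refl : core.

Lemma cox_widen n n' v w : n <= n' -> cox n v w -> cox n' v w.
Proof.
move=> le_n; elim=> {v w} //.
- by move=> v w _; apply: cox_sym.
- by move=> u v w _ uv _; apply: cox_trans.
- by move=> u u' v v' _ uu' _; apply: cox_cat.
- by move=> i lt_i; apply: cox_invol; lia.
- by move=> i lt_i; apply: cox_braid; lia.
- by move=> i j lt_i lt_j; apply: cox_comm; lia.
Qed.

(* [:: n; n - 1; ...; n - k + 1] *)
Fixpoint desc n k :=
  if k is k'.+1 then rcons (desc n k') (n - k') else [::].

Lemma desc_comm n k i : i.+1 + k <= n ->
  cox n.+1 (desc n k ++ [:: i]) (i :: desc n k).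
Proof.
elim: k => [|k IHk] lek //=; rewrite cat_rcons.
apply: (cox_trans (v := desc n k ++ [:: i; n - k])).
  by apply: cox_cat => //; apply/cox_sym/cox_comm; lia.
have -> : desc n k ++ [:: i; n - k] = (desc n k ++ [:: i]) ++ [:: n - k].
  by rewrite -catA.
rewrite -cats1 -cat_cons; apply: cox_cat => //; apply: IHk; lia.
Qed.

Lemma desc_shift n k i : k <= n.+1 -> i < n -> n < i + k ->
  cox n.+1 (desc n k ++ [:: i.+1]) (i :: desc n k).
Proof.
elim: k i => [|k IHk] i lek lti lik /=; first by lia.
rewrite cat_rcons; case: (ltnP n (i + k)) => [lt|ge].
  apply: (cox_trans (v := desc n k ++ [:: i.+1; n - k])).
    by apply: cox_cat => //; apply: cox_comm; lia.
  have -> : desc n k ++ [:: i.+1; n - k] = (desc n k ++ [:: i.+1]) ++ [:: n - k].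
    by rewrite -catA.
  by rewrite -cats1 -cat_cons; apply: cox_cat => //; apply: IHk; lia.
have Di : n - k = i by lia.
case: k {IHk} lek lik ge Di => [|k] /= lek lik ge Di; first by lia.
have -> : n - k = i.+1 by lia.
rewrite Di cat_rcons; apply: (cox_trans (v := desc n k ++ [:: i; i.+1; i])).
  by apply: cox_cat => //; apply/cox_sym/cox_braid; lia.
have -> : desc n k ++ [:: i; i.+1; i] = (desc n k ++ [:: i]) ++ [:: i.+1; i].
  by rewrite -catA.
have -> : i :: rcons (rcons (desc n k) i.+1) i = (i :: desc n k) ++ [:: i.+1; i].
  by rewrite -!cats1 -catA.
by apply: cox_cat => //; apply: desc_comm; lia.
Qed.

Lemma cox_normal n w : all (gtn n.+1) w ->
  exists u k, [/\ all (gtn n) u, k <= n.+1 & cox n.+1 w (u ++ desc n k)].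
Proof.
elim/last_ind: w => [|w i IHw]; first by exists [::], 0.
rewrite all_rcons => /andP[/= lti /IHw[u [k [ltu lek Dw]]]] {IHw}.
have {}Dw : cox n.+1 (rcons w i) (u ++ (desc n k ++ [:: i])).
  by rewrite catA cats1 -cats1 -[X in cox _ _ X]cats1; apply: cox_cat.
have absorb v k' : all (gtn n) v -> k' <= n.+1 ->
    cox n.+1 (desc n k ++ [:: i]) (v ++ desc n k') ->
    exists u k, [/\ all (gtn n) u, k <= n.+1 & cox n.+1 (rcons w i) (u ++ desc n k)].
  move=> ltv lek' E; exists (u ++ v), k'; split=> //; first by rewrite all_cat ltu.
  by apply: cox_trans Dw _; rewrite -catA; apply: cox_cat.
case: (ltngtP (i + k) n) => [lt|gt|eq].
- by apply: (absorb [:: i] k) => //=; [lia | apply: desc_comm; lia].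
- case: k lek gt Dw absorb => [|k] lek gt Dw absorb; first by lia.
  case: (ltngtP (i + k) n) => [|lt|eq]; first by lia.
    case: i lti lt Dw absorb {gt} => [|i] lti lt Dw absorb; first by lia.
    by apply: (absorb [:: i] k.+1) => //; [rewrite /=; lia | apply: desc_shift; lia].
  apply: (absorb [::] k) => //; first by lia.
  rewrite /= cat_rcons; have -> : n - k = i by lia.
  rewrite -[X in cox _ _ X]cats0; apply: cox_cat => //; exact: cox_invol.
- apply: (absorb [::] k.+1) => //=; first by lia.
  by rewrite cats1; have -> : n - k = i by lia.
Qed.

Definition swap i x := if x == i then i.+1 else if x == i.+1 then i else x.
Definition act (w : seq nat) x := foldl (fun x i => swap i x) x w.

Lemma swapK i : involutive (swap i).
Proof.
by move=> x; rewrite /swap; do 2![case: eqP => //]; do ?case: eqP => //; lia.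
Qed.

Lemma act_cat v w x : act (v ++ w) x = act w (act v x).
Proof. exact: foldl_cat. Qed.

Lemma act_rev w x : act (rev w) (act w x) = x.
Proof.
elim: w x => //= i w IHw x; by rewrite rev_cons -cats1 act_cat IHw /= swapK.
Qed.

Lemma cox_act n v w : cox n v w -> act v =1 act w.
Proof.
elim=> {v w} //.
- by move=> v w _ vw x; rewrite (vw x).
- by move=> u v w _ uv _ vw x; rewrite (uv x).
- by move=> u u' v v' _ uu' _ vv' x; rewrite !act_cat (uu' x) (vv' _).
- by move=> i _ x; rewrite /= swapK.
- move=> i _ x; rewrite /= /swap.
  by do ?[case: eqP => //]; lia.
- move=> i j ltij _ x; rewrite /= /swap.
  by do ?[case: eqP => //]; lia.
Qed.

Lemma act_fix n w x : all (gtn n) w -> n < x -> act w x = x.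
Proof.
elim: w x => //= i w IHw x /andP[lti ltw] ltx.
have -> : swap i x = x by rewrite /swap; do ?[case: eqP => //]; lia.
exact: IHw.
Qed.

Lemma act_desc n k : k <= n.+1 -> act (desc n k) n.+1 = n.+1 - k.
Proof.
elim: k => [|k IHk] lek //=; rewrite -cats1 act_cat IHk /=; last by lia.
by rewrite /swap; do ?[case: eqP => //]; lia.
Qed.

Lemma cox_complete n w : all (gtn n) w -> act w =1 id -> cox n w [::].
Proof.
elim: n w => [[|//]|n IHn] w //= /cox_normal[u [k [ltu lek Dw]]] w1.
have k0 : k = 0.
  have := cox_act Dw n.+1; rewrite w1 act_cat (act_fix ltu) // act_desc //; lia.
move: Dw; rewrite k0 cats0 => Dw; apply: (cox_trans (Dw)).
apply: (@cox_widen n) => //; apply: IHn => // x; rewrite -(cox_act Dw); exact: w1.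
Qed.

Lemma cox_revl n w : all (gtn n) w -> cox n (rev w ++ w) [::].
Proof.
elim: w => //= i w IHw /andP[lti /IHw Dw]; rewrite rev_cons cat_rcons.
apply: cox_trans Dw; apply: cox_cat => //; rewrite -[X in cox _ _ X]cat0s -[i :: i :: w]/([:: i; i] ++ w).
by apply: cox_cat => //; apply: cox_invol.
Qed.

Lemma cox_eq n v w :
  all (gtn n) v -> all (gtn n) w -> act v =1 act w -> cox n v w.
Proof.
move=> ltv ltw vw; apply: (@cox_trans _ _ (v ++ rev w ++ w)).
  by rewrite -[X in cox _ X _]cats0; apply: cox_cat => //; apply/cox_sym/cox_revl.
rewrite catA -[X in cox _ _ X]cat0s; apply: cox_cat => //.
apply: cox_complete => [|x]; first by rewrite all_cat ltv all_rev.
by rewrite act_cat vw act_rev.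
Qed.

Lemma cast_id n m (en : n = n) (em : m = m) (f : arrow n m) : cast en em f = f.
Proof. by rewrite (eq_axiomK en) (eq_axiomK em). Qed.

(* Equality of morphisms whose source and target are only propositionally
   equal. *)
Definition heq n m n' m' (f : arrow n m) (g : arrow n' m') :=
  exists en em, cast en em f ≡ g.
Notation "f ≈ g" := (heq f g) (at level 70, no associativity) : prop_scope.

Lemma heqE n m (f g : arrow n m) : f ≈ g -> f ≡ g.
Proof. by case=> en [em]; rewrite cast_id. Qed.

Lemma eq_heq n m (f g : arrow n m) : f ≡ g -> f ≈ g.
Proof. by exists erefl, erefl. Qed.

Lemma heq_refl n m (f : arrow n m) : f ≈ f.
Proof. exact/eq_heq/beq_refl. Qed.
#[local] Hint Resolve beq_refl heq_refl : core.

Lemma heq_sym n m n' m' (f : arrow n m) (g : arrow n' m') : f ≈ g -> g ≈ f.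
Proof. by case=> en [em]; subst n' m'; rewrite cast_id => /beq_sym/eq_heq. Qed.

Lemma heq_trans n m n' m' n'' m'' (g : arrow n' m') (f : arrow n m)
  (h : arrow n'' m'') : f ≈ g -> g ≈ h -> f ≈ h.
Proof.
case=> en [em]; subst n' m'; rewrite cast_id => fg.
case=> en [em]; subst n'' m''; rewrite cast_id => gh.
exact/eq_heq/(beq_trans fg gh).
Qed.

Lemma heq_cast n m n' m' (en : n = n') (em : m = m') (f : arrow n m) :
  cast en em f ≈ f.
Proof. by subst n' m'; rewrite cast_id. Qed.

Lemma heq_comp n m k n' m' k' (g : arrow m k) (f : arrow n m)
    (g' : arrow m' k') (f' : arrow n' m') :
  g ≈ g' -> f ≈ f' -> g ∘ f ≈ g' ∘ f'.
Proof.
case=> em [ek]; subst m' k'; rewrite cast_id => gg'.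
case=> en [em]; subst n'; rewrite cast_id => ff'.
exact/eq_heq/beq_comp.
Qed.

Lemma heq_tens n m k l n' m' k' l' (f : arrow n m) (g : arrow k l)
    (f' : arrow n' m') (g' : arrow k' l') :
  f ≈ f' -> g ≈ g' -> f ⊗ g ≈ f' ⊗ g'.
Proof.
case=> en [em]; subst n' m'; rewrite cast_id => ff'.
case=> en [em]; subst k' l'; rewrite cast_id => gg'.
exact/eq_heq/beq_tens.
Qed.

Lemma heq_tensA n m n' m' n'' m'' (f : arrow n m) (f' : arrow n' m')
    (f'' : arrow n'' m'') : f ⊗ (f' ⊗ f'') ≈ f ⊗ f' ⊗ f''.
Proof. exact: heq_trans (heq_sym (heq_cast _ _ _)) (eq_heq (tens_assoc _ _ _)). Qed.

Lemma heq_tens0 n m (f : arrow n m) : f ⊗ Id 0 ≈ f.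
Proof. exact: heq_trans (heq_sym (heq_cast _ _ _)) (eq_heq (tens_unitr _)). Qed.

Lemma heq_Id n m : n = m -> Id n ≈ Id m.
Proof. by move->. Qed.

Definition whisker i j n m (f : arrow n m) : arrow (i + (n + j)) (i + (m + j)) :=
  Id i ⊗ (f ⊗ Id j).

Lemma whisker_eq i j n m (f g : arrow n m) : f ≡ g -> whisker i j f ≡ whisker i j g.
Proof. by move=> fg; do 2!apply: beq_tens => //. Qed.

Lemma whisker_comp i j n m k (g : arrow m k) (f : arrow n m) :
  whisker i j (g ∘ f) ≡ whisker i j g ∘ whisker i j f.
Proof.
rewrite /whisker; apply: beq_sym; apply: beq_trans (tens_interchange _ _ _ _) _.
apply: beq_tens; first exact: comp_idl.
by apply: beq_trans (tens_interchange _ _ _ _) _; apply: beq_tens => //; exact: comp_idl.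
Qed.

Lemma whisker_Id i j n : whisker i j (Id n) ≡ Id _.
Proof. by apply: beq_trans (beq_tens _ (tens_id _ _)) (tens_id _ _). Qed.

Lemma whisker_whisker i j i' j' n m (f : arrow n m) :
  whisker i j (whisker i' j' f) ≈ whisker (i + i') (j' + j) f.
Proof.
apply: heq_trans (heq_tensA _ _ _) _.
apply: heq_trans (heq_tens (heq_tensA _ _ _) (heq_refl _)) _.
apply: heq_trans (heq_tens (heq_tens (eq_heq (tens_id _ _)) (heq_refl _)) (heq_refl _)) _.
apply: heq_trans (heq_sym (heq_tensA _ _ _)) _; apply: heq_tens => //.
apply: heq_trans (heq_sym (heq_tensA _ _ _)) _; apply: heq_tens => //.
exact/eq_heq/tens_id.
Qed.

(* [adj_arrow] on all of nat, trivial out of range. *)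
Definition gen s (k : nat) : arrow s s := oapp (@adj_arrow s) (Id s) (insub k).

Lemma gen_ord s (i : 'I_s.-1) : gen s i = adj_arrow i.
Proof. by rewrite /gen insubT //= => lti; congr adj_arrow; apply/val_inj. Qed.

Lemma gen_whisker s k i j n a b (f : arrow n n) :
    s = i + (n + j) -> k = i + a -> n = a + (2 + b) ->
    f ≈ whisker a b P11 ->
  gen s k ≈ whisker i j f.
Proof.
move=> Ds Dk Dn Df; have lt_k : k < s.-1 by lia.
rewrite -[k]/(val (Ordinal lt_k)) gen_ord; apply: heq_trans (heq_cast _ _ _) _.
apply: (@heq_trans _ _ _ _ _ _ (whisker (i + a) (b + j) P11)).
  apply: heq_tens; first exact: heq_Id.
  by apply: heq_tens => //; apply: heq_Id => /=; lia.
apply: heq_trans (heq_sym (whisker_whisker _ _ _ _ _)) _.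
by do 2!apply: heq_tens => //; exact: heq_sym.
Qed.

Lemma heq_whisker i j n m n' m' (f : arrow n m) (g : arrow n' m') :
  f ≈ g -> whisker i j f ≈ whisker i j g.
Proof. by move=> fg; do 2!apply: heq_tens => //. Qed.

Lemma braid3 : (P11 ⊗ Id 1) ∘ (Id 1 ⊗ P11) ∘ (P11 ⊗ Id 1)
             ≡ (Id 1 ⊗ P11) ∘ (P11 ⊗ Id 1) ∘ (Id 1 ⊗ P11).
Proof.
have hex : Symm 1 2 ≡ (Id 1 ⊗ P11) ∘ (P11 ⊗ Id 1).
  by have := sym_hexagon 1 1 1; rewrite !cast_id.
have := sym_natural (Id 1) P11 => nat.
apply: beq_trans (beq_sym (comp_assoc _ _ _)) _.
apply: beq_trans (beq_comp (beq_refl _) (beq_sym hex)) _.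
apply: beq_trans (beq_sym nat) _.
exact: beq_comp hex (beq_refl _).
Qed.

Lemma gen_invol s i : i < s.-1 -> gen s i ∘ gen s i ≡ Id s.
Proof.
move=> lti; have Ds : s = i + (2 + (s - i - 2)) by lia.
have Dg : gen s i ≈ whisker i (s - i - 2) P11.
  apply: (@gen_whisker _ _ _ _ _ 0 0) => //; first by rewrite addn0.
  apply: heq_sym; apply: heq_trans (eq_heq (tens_unitl _)) _; exact: heq_tens0.
apply/heqE/(heq_trans (heq_comp Dg Dg)).
apply: heq_trans (eq_heq (beq_sym (whisker_comp _ _ _ _))) _.
apply: heq_trans (eq_heq (whisker_eq _ _ (sym_invol 1 1))) _.
by apply: heq_trans (eq_heq (whisker_Id _ _ _)) _; exact: heq_Id.
Qed.

Lemma gen_braid s i : i.+1 < s.-1 ->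
  gen s i ∘ gen s i.+1 ∘ gen s i ≡ gen s i.+1 ∘ gen s i ∘ gen s i.+1.
Proof.
move=> lti; have Ds : s = i + (3 + (s - i - 3)) by lia.
have Dg : gen s i ≈ whisker i (s - i - 3) (P11 ⊗ Id 1).
  apply: (@gen_whisker _ _ _ _ _ 0 1) => //; first by rewrite addn0.
  by apply: heq_sym; apply: eq_heq (tens_unitl _).
have Dg' : gen s i.+1 ≈ whisker i (s - i - 3) (Id 1 ⊗ P11).
  apply: (@gen_whisker _ _ _ _ _ 1 0) => //; first by rewrite addn1.
  by apply: heq_tens => //; apply: heq_sym; exact: heq_tens0.
have comp3 (f g h : arrow 3 3) j :
    whisker i j f ∘ whisker i j g ∘ whisker i j h ≡ whisker i j (f ∘ g ∘ h).
  apply/beq_sym/(beq_trans (whisker_comp _ _ _ _))/beq_comp => //.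
  exact: whisker_comp.
apply/heqE.
apply: heq_trans (heq_comp (heq_comp Dg Dg') Dg) _.
apply: heq_trans (heq_sym (heq_comp (heq_comp Dg' Dg) Dg')).
apply: heq_trans (eq_heq (comp3 _ _ _ _)) _.
apply: heq_trans (heq_sym (eq_heq (comp3 _ _ _ _))).
exact/eq_heq/whisker_eq/braid3.
Qed.

Lemma gen_comm s i j : i.+1 < j -> j < s.-1 ->
  gen s i ∘ gen s j ≡ gen s j ∘ gen s i.
Proof.
move=> ltij ltj; pose c := j - i - 2; pose l := s - j - 2.
have Ds : s = i + ((2 + c + 2) + l) by rewrite /c /l; lia.
have Dg : gen s i ≈ whisker i l (P11 ⊗ Id c ⊗ Id 2).
  apply: (@gen_whisker _ _ _ _ _ 0 (c + 2)) => //; first by rewrite addn0.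
  apply: heq_sym; apply: heq_trans (eq_heq (tens_unitl _)) _.
  apply: (heq_trans _ (heq_tensA _ _ _));
  exact: (heq_tens (heq_refl P11) (eq_heq (beq_sym (tens_id _ _)))).
have Dg' : gen s j ≈ whisker i l (Id (2 + c) ⊗ P11).
  apply: (@gen_whisker _ _ _ _ _ (2 + c) 0) => //; first by rewrite /c; lia.
  by apply: heq_tens => //; apply: heq_sym; exact: heq_tens0.
apply/heqE.
apply: heq_trans (heq_comp Dg Dg') _.
apply: heq_trans (heq_sym (heq_comp Dg' Dg)).
apply: heq_trans (eq_heq (beq_sym (whisker_comp _ _ _ _))) _.
apply: heq_trans (eq_heq (whisker_comp _ _ _ _)).
apply/eq_heq/whisker_eq.
apply: beq_trans (tens_interchange _ _ _ _) _.
apply/beq_sym/(beq_trans (tens_interchange _ _ _ _))/beq_tens.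
  exact: beq_trans (comp_idl _) (beq_sym (comp_idr _)).
exact: beq_trans (comp_idr _) (beq_sym (comp_idl _)).
Qed.

Fixpoint gens s (w : seq nat) : arrow s s :=
  if w is i :: w' then gens s w' ∘ gen s i else Id s.

Lemma gens_cat s v w : gens s (v ++ w) ≡ gens s w ∘ gens s v.
Proof.
elim: v => [|i v IHv] /=; first exact/beq_sym/comp_idr.
by apply: beq_trans (beq_comp IHv (beq_refl _)) _; exact/beq_sym/comp_assoc.
Qed.

Lemma gens_cox s v w : cox s.-1 v w -> gens s v ≡ gens s w.
Proof.
elim=> {v w} //.
- by move=> v w _; apply: beq_sym.
- by move=> u v w _ uv _; apply: beq_trans.
- move=> u u' v v' _ uu' _ vv'; apply: beq_trans (gens_cat _ _ _) _.
  by apply: beq_trans (beq_sym (gens_cat _ _ _)); exact: beq_comp.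
- move=> i lti /=; apply: beq_trans (beq_sym (comp_assoc _ _ _)) _.
  by apply: beq_trans (comp_idl _) _; exact: gen_invol.
- move=> i lti /=.
  have e (f g h : arrow s s) : Id s ∘ f ∘ g ∘ h ≡ f ∘ g ∘ h.
    by do 2!apply: beq_comp => //; exact: comp_idl.
  apply: beq_trans (e _ _ _) (beq_trans _ (beq_sym (e _ _ _))); exact: gen_braid.
- move=> i j ltij ltj /=.
  have e (f g : arrow s s) : Id s ∘ f ∘ g ≡ f ∘ g.
    by apply: beq_comp => //; exact: comp_idl.
  apply: beq_trans (e _ _) (beq_trans _ (beq_sym (e _ _))).
  exact/beq_sym/gen_comm.
Qed.

Section Characterisation.
Variable s : nat.

Lemma word_arrow_gens (w : seq 'I_s.-1) : word_arrow w = gens s (map val w).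
Proof. by elim: w => //= i w ->; rewrite -gen_ord. Qed.

Lemma act_word (w : seq 'I_s.-1) (x : 'I_s) :
  act (map val w) x = word_perm w x.
Proof.
elim: w x => [|i w IHw] x /=; first by rewrite /word_perm big_nil perm1.
rewrite /word_perm big_cons permM -/(word_perm w) -IHw; congr act.
rewrite /adj_perm /swap; case: tpermP => [->|->|/eqP + /eqP].
- by rewrite eqxx.
- by rewrite /= eqxx; case: eqP => //; lia.
- by rewrite -!val_eqE /= => /negPf-> /negPf->.
Qed.

Lemma word_arrow_eq (v w : seq 'I_s.-1) :
  word_perm v = word_perm w -> word_arrow v ≡ word_arrow w.
Proof.
move=> vw; rewrite !word_arrow_gens; apply: gens_cox.
have ltw (u : seq 'I_s.-1) : all (gtn s.-1) (map val u).
  by apply/allP=> _ /mapP[i _ ->] /=; exact: ltn_ord.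
apply: cox_eq => // x; case: (ltnP x s) => [ltx|gex].
  by rewrite -[x]/(val (Ordinal ltx)) !act_word vw.
case: s v w {vw} ltw gex => [|n] v w ltw gex; first by case: v w => [|[]//] [|[]].
by rewrite !(act_fix (ltw _)).
Qed.

Lemma perm_arrow_word (w : seq 'I_s.-1) : perm_arrow (word_perm w) ≡ word_arrow w.
Proof. by apply: word_arrow_eq; rewrite -(eqP (xchooseP (adj_generate _))). Qed.

Lemma word_arrow_cat (v w : seq 'I_s.-1) :
  word_arrow (v ++ w) ≡ word_arrow w ∘ word_arrow v.
Proof. by rewrite !word_arrow_gens map_cat; exact: gens_cat. Qed.

Lemma perm_arrow1 : perm_arrow (1 : 'S_s) ≡ Id s.
Proof.
have -> : (1 : 'S_s)%g = word_perm [::] by rewrite /word_perm big_nil.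
exact: perm_arrow_word.
Qed.

(* [x * y] is "x, then y". *)
Lemma perm_arrowM (x y : 'S_s) : perm_arrow (x * y) ≡ perm_arrow y ∘ perm_arrow x.
Proof.
have [v /eqP Dx] := adj_generate x; have [w /eqP Dy] := adj_generate y.
have -> : (x * y)%g = word_perm (v ++ w) by rewrite Dx Dy /word_perm big_cat.
apply: beq_trans (perm_arrow_word _) _.
apply: beq_trans (word_arrow_cat _ _) _; apply/beq_sym.
by rewrite Dx Dy; apply: beq_comp; exact: perm_arrow_word.
Qed.

Lemma perm_arrow_adj (i : 'I_s.-1) : perm_arrow (adj_perm i) ≡ adj_arrow i.
Proof.
have -> : adj_perm i = word_perm [:: i] by rewrite /word_perm big_seq1.
apply: beq_trans (perm_arrow_word _) _; exact: comp_idl.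
Qed.

Lemma perm_arrow_unique (F : 'S_s -> arrow s s) :
    F 1%g ≡ Id s ->
    (forall x y, F (x * y)%g ≡ F y ∘ F x) ->
    (forall i, F (adj_perm i) ≡ adj_arrow i) ->
  forall x, F x ≡ perm_arrow x.
Proof.
move=> F1 FM Fadj x; have [w /eqP ->] := adj_generate x.
apply: beq_trans (beq_sym (perm_arrow_word _)).
elim: w => [|i w IHw] /=; first by rewrite /word_perm big_nil.
rewrite /word_perm big_cons -/(word_perm w).
apply: beq_trans (FM _ _) _; exact: beq_comp.
Qed.

End Characterisation.

End PermArrow.

(* Main.v *)
Require Import Defs.
From mathcomp Require Import all_boot all_fingroup zify.
From Stdlib Require Import Setoid Morphisms.
Import PermArrow.

(** Existence. Call an arrow algebraic when it is a permutation followed by a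
    tensor product of iterated multiplications, and coalgebraic when its
    mirror image is algebraic. Associativity and naturality of the symmetry
    make algebraic arrows closed under composition and tensor
    ([algebraic_comp], [algebraic_tens]); since reversing all arrows preserves
    the relations ([op_beq]), so are coalgebraic arrows. It remains to see that
    a coalgebraic arrow after an algebraic one can be rewritten as an algebraic
    arrow after a coalgebraic one. By the normal forms this reduces to
    [delta_iter k ∘ mu_iter j]. There the bialgebra law first moves all of
    [delta_iter k] past a single [Mu] (induction on [k], [delta_iter_Mu]); a
    second induction, on [j] for all [k] at once, deals with the remaining
    multiplications, because what is left over above them is again a tensor
    product of iterated comultiplications ([delta_iter_mu_iter]). So every
    arrow is algebraic after coalgebraic ([all_separated]), and merging the two
    permutations gives the factorization.

    Uniqueness. It suffices to find one bialgebra that tells factorizations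
    apart. We use the category of sets and relations with the cartesian
    product, and in it the free monoid on the coalgebra of matrix units: the
    letters are pairs (a, b) of numbers, and (a, b) is comultiplied into
    (a, c), (c, b) for an arbitrary c. The relation [sem f] attached to an
    arrow respects all the relations of the PROP ([sem_beq]). Now
    [delta_iter k] sends the letter (a, a + k) to the path
    (a, a + 1), ..., (a + k - 1, a + k), among other things. Feeding a
    factorization with letters whose paths form the chain
    (0, 1), ..., (s - 1, s), we get an output in which all letters are steps
    (i, i + 1) and pairwise distinct. Another factorization with the same
    relation must produce that output: the lengths of the output words are the
    [q_j], since the letters are steps the [p_i] are the differences b - a of
    the input letters, and since they are distinct their order determines the
    permutation ([factorization_unique]). *)

Set Implicit Arguments.
Unset Strict Implicit.
Unset Printing Implicit Defensive.

Local Open Scope prop_scope.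

#[local] Hint Resolve beq_refl heq_refl : core.

#[local] Instance beq_equivalence n m : Equivalence (@beq n m).
Proof. by split; [exact: beq_refl | exact: beq_sym | exact: beq_trans]. Qed.

#[local] Instance Comp_proper n m k :
  Proper (@beq m k ==> @beq n m ==> @beq n k) (@Comp n m k).
Proof. by move=> g g' gg' f f' ff'; exact: beq_comp. Qed.

#[local] Instance Tens_proper n m n' m' :
  Proper (@beq n m ==> @beq n' m' ==> @beq (n + n') (m + m')) (@Tens n m n' m').
Proof. by move=> g g' gg' f f' ff'; exact: beq_tens. Qed.

Lemma heq_transl n m n' m' n'' m'' (f : arrow n m) (g : arrow n' m')
  (h : arrow n'' m'') : f ≈ g -> f ≈ h -> g ≈ h.
Proof. by move=> /heq_sym; exact: heq_trans. Qed.

Lemma tens_split n m n' m' (f : arrow n m) (g : arrow n' m') :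
  f ⊗ g ≡ (f ⊗ Id m') ∘ (Id n ⊗ g).
Proof. by rewrite tens_interchange comp_idl comp_idr. Qed.

Lemma heq_dim n m n' m' (f : arrow n m) (g : arrow n' m') :
  f ≈ g -> n = n' /\ m = m'.
Proof. by case=> en [em _]. Qed.

Lemma heq_Tens0 n m (f : arrow n m) : Id 0 ⊗ f ≈ f.
Proof. exact/eq_heq/tens_unitl. Qed.

(** * Permutation arrows *)

(** Words in [gens] rather than elements of 'S_n: the target need not be
    syntactically the source, and letters out of range are harmless. *)
Definition permutative n m (f : arrow n m) := exists w, f ≈ gens n w.

Lemma permutative_heq n m n' m' (f : arrow n m) (g : arrow n' m') :
  f ≈ g -> permutative f -> permutative g.
Proof.
case=> en [em]; subst n' m'; rewrite cast_id => fg [w fw]; exists w.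
exact: heq_transl (eq_heq fg) fw.
Qed.

Lemma permutative_dim n m (f : arrow n m) : permutative f -> m = n.
Proof. by case=> w [_ [em _]]. Qed.

Lemma permutative_Id n : permutative (Id n).
Proof. by exists [::]. Qed.
#[local] Hint Resolve permutative_Id : core.

Lemma permutative_comp n m k (g : arrow m k) (f : arrow n m) :
  permutative g -> permutative f -> permutative (g ∘ f).
Proof.
move=> Pg Pf; have em := permutative_dim Pf; have ek := permutative_dim Pg.
subst k m; case: Pg Pf => [v gv] [w fw]; exists (w ++ v).
by apply: heq_trans (heq_comp gv fw) (eq_heq _); rewrite gens_cat.
Qed.

(** Shifting an adjacent transposition by [i] gives an adjacent transposition. *)
Lemma permutative_whisker i j n m (f : arrow n m) :
  permutative f -> permutative (whisker i j f).
Proof.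
move=> Pf; have em := permutative_dim Pf; subst m; case: Pf => w fw.
apply: (permutative_heq (heq_sym (heq_whisker i j fw))) => {f fw}.
elim: w => [|k w IHw] /=.
  by apply: permutative_heq (permutative_Id _); apply/eq_heq/beq_sym/whisker_Id.
apply: permutative_heq (eq_heq (beq_sym (whisker_comp _ _ _ _))) _.
apply: permutative_comp => //; case: (ltnP k n.-1) => [ltk|gek]; last first.
  rewrite /gen insubN /= -?leqNgt //.
  by apply: permutative_heq (permutative_Id _); apply/eq_heq/beq_sym/whisker_Id.
exists [:: i + k] => /=; apply: heq_sym.
apply: (heq_trans (eq_heq (comp_idl _))).
apply: (@gen_whisker _ _ _ _ _ k (n - k - 2)) => //; first by lia.
rewrite -[k in gen n k]/(val (Ordinal ltk)) gen_ord; exact: heq_cast.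
Qed.

Lemma permutative_tens n m n' m' (f : arrow n m) (g : arrow n' m') :
  permutative f -> permutative g -> permutative (f ⊗ g).
Proof.
move=> Pf Pg; apply: permutative_heq (eq_heq (beq_sym (tens_split f g))) _.
apply: permutative_comp.
  by apply: permutative_heq (heq_Tens0 _) (permutative_whisker 0 m' Pf).
apply: permutative_heq (permutative_whisker n 0 Pg).
by apply: heq_tens => //; exact: heq_tens0.
Qed.


(** With both inner objects 0, the hexagon makes [Symm n 0] idempotent; being
    invertible, it is an identity. *)
Lemma Symm_n0 n : Symm n 0 ≈ Id n.
Proof.
pose f : arrow n n := cast (addn0 n) erefl (Symm n 0).
pose g : arrow n n := cast erefl (addn0 n) (Symm 0 n).
have Df : Symm n 0 ≈ f by apply/heq_sym/heq_cast.
have Dg : Symm 0 n ≈ g by apply/heq_sym/heq_cast.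
have gf : g ∘ f ≡ Id n.
  apply: heqE; apply: heq_trans (heq_comp (heq_sym Dg) (heq_sym Df)) _.
  apply: heq_trans (eq_heq (sym_invol n 0)) (heq_Id _); exact: addn0.
have ff : f ∘ f ≡ f.
  apply: heqE; apply: (heq_trans _ Df); apply: heq_sym.
  apply: heq_trans (heq_sym (heq_cast (addnA n 0 0) (esym (addnA 0 0 n)) _)) _.
  apply: heq_trans (eq_heq (sym_hexagon n 0 0)) _; apply: heq_comp.
    exact: heq_trans (heq_Tens0 _) Df.
  apply: heq_trans (heq_cast _ _ _) _; exact: heq_trans (heq_tens0 _) Df.
apply: heq_trans Df (eq_heq _).
by rewrite -[f]comp_idl -gf -comp_assoc ff gf.
Qed.

Lemma gens_rev s w : gens s (rev w) ∘ gens s w ≡ Id s.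
Proof.
elim: w => [|i w IHw] /=; first exact: comp_idl.
rewrite rev_cons -cats1 gens_cat /= comp_idl.
rewrite -comp_assoc [gens _ _ ∘ (_ ∘ _)]comp_assoc IHw comp_idl.
case: (ltnP i s.-1) => [/gen_invol //|gei].
by rewrite /gen insubN ?comp_idl // -leqNgt.
Qed.

Lemma Symm_inv n m (f : arrow (m + n) (n + m)) :
  f ∘ Symm n m ≡ Id _ -> Symm m n ≡ f.
Proof.
by move=> fS; rewrite -[f]comp_idr -(sym_invol m n) comp_assoc fS comp_idl.
Qed.

Lemma permutative_Symm n m : permutative (Symm n m).
Proof.
(* The hexagon reduces the second index to 1, involutivity exchanges the two
   indices, and adjacent transpositions remain. *)
have hex (a b : nat) : permutative (Symm a b) -> permutative (Symm a 1) ->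
    permutative (Symm a (b + 1)).
  move=> Pb P1.
  apply: permutative_heq (heq_cast (addnA a b 1) (esym (addnA b 1 a)) _) _.
  apply: permutative_heq (eq_heq (beq_sym (sym_hexagon a b 1))) _.
  apply: permutative_comp; first by apply: permutative_tens.
  by apply: permutative_heq (heq_sym (heq_cast _ _ _)) _; apply: permutative_tens.
have swap a b : permutative (Symm a b) -> permutative (Symm b a).
  move=> Pab; have [w Dw] := Pab.
  pose f := cast (addnC a b) erefl (gens (a + b) (rev w)).
  have Df : f ≈ gens (a + b) (rev w) by apply: heq_cast.
  apply: (@permutative_heq _ _ _ _ f).
    apply/eq_heq/beq_sym/Symm_inv/heqE.
    apply: heq_trans (heq_comp Df Dw) _; exact/eq_heq/gens_rev.
  by apply: permutative_heq (heq_sym Df) _; exists (rev w).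
have sym1 a : permutative (Symm a 1).
  elim: a => [|a IHa].
    by apply/swap; apply: permutative_heq (heq_sym (Symm_n0 _)) (permutative_Id _).
  have -> : a.+1 = a + 1 by rewrite addn1.
  apply/swap/hex; first exact/swap.
  (* [Symm 1 1] is the adjacent transposition of index 0. *)
  exists [:: 0] => /=; apply: heq_sym.
  apply: heq_trans (eq_heq (comp_idl _)) _.
  apply: heq_trans (@gen_whisker 2 0 0 0 2 0 0 P11 erefl erefl erefl _) _.
    by apply: heq_sym; apply: heq_trans (heq_Tens0 _) (heq_tens0 _).
  exact: heq_trans (heq_Tens0 _) (heq_tens0 _).
elim: m => [|m IHm].
  by apply: permutative_heq (heq_sym (Symm_n0 _)) (permutative_Id _).
have -> : m.+1 = m + 1 by rewrite addn1.
exact: hex.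
Qed.

Lemma permutative_perm_arrow n (f : arrow n n) :
  permutative f -> exists x : 'S_n, f ≡ perm_arrow x.
Proof.
case=> w /heqE fw.
suff [x wx] : exists x : 'S_n, gens n w ≡ perm_arrow x by exists x; rewrite fw.
elim: w {f fw} => [|i w [x wx]] /=; first by exists 1%g; rewrite perm_arrow1.
case: (ltnP i n.-1) => [lti|gei].
  exists (adj_perm (Ordinal lti) * x)%g.
  by rewrite perm_arrowM perm_arrow_adj -wx -gen_ord.
by exists x; rewrite wx /gen insubN ?comp_idr // -leqNgt.
Qed.

(** * Iterated multiplications *)

(** The defining recursion, extended to [k = 0] by the unit law. *)
Lemma mu_iterS k : mu_iter k.+1 ≈ Mu ∘ (mu_iter k ⊗ Id 1).
Proof.
case: k => [|k]; first exact/heq_sym/eq_heq/mu_unitl.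
exact: heq_cast.
Qed.

(** The target of a product of two arrows into 1 is stated as 2, which does not
    unify with a sum of two unknowns. *)
Lemma heq_tens2 n k n' k' (f : arrow n 1) (g : arrow k 1)
    (f' : arrow n' 1) (g' : arrow k' 1) :
  f ≈ f' -> g ≈ g' -> @heq _ 2 _ 2 (f ⊗ g) (f' ⊗ g').
Proof. exact: heq_tens. Qed.

Lemma Mu_interchange n n' m m' (g : arrow m 1) (g' : arrow m' 1)
    (f : arrow n m) (f' : arrow n' m') :
  Mu ∘ (g ⊗ g') ∘ (f ⊗ f') ≡ Mu ∘ ((g ∘ f) ⊗ (g' ∘ f')).
Proof.
rewrite -comp_assoc; apply: beq_comp => //; exact: (tens_interchange g f g' f').
Qed.

Lemma mu_iterD a b : Mu ∘ (mu_iter a ⊗ mu_iter b) ≈ mu_iter (a + b).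
Proof.
elim: b => [|b IHb].
  apply: (@heq_trans _ _ _ _ _ _ (mu_iter a)); last by rewrite addn0.
  have e : mu_iter a ⊗ Eta ≈ (Id 1 ⊗ Eta) ∘ mu_iter a.
    apply: (heq_trans _ (heq_comp (heq_refl _) (heq_tens0 _))).
    by apply: eq_heq; rewrite tens_interchange comp_idl comp_idr.
  apply: heq_trans (heq_comp (heq_refl _) e) (eq_heq _).
  by rewrite comp_assoc mu_unitr comp_idl.
apply: (@heq_trans _ _ _ _ _ _ (mu_iter (a + b).+1)); last by rewrite addnS.
apply: (heq_trans _ (heq_sym (mu_iterS (a + b)))).
apply: (@heq_trans _ _ _ _ _ _ (Mu ∘ (mu_iter a ⊗ (Mu ∘ (mu_iter b ⊗ Id 1))))).
  by apply: heq_comp => //; apply: heq_tens2 => //; exact: mu_iterS.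
apply: (@heq_trans _ _ _ _ _ _
    (Mu ∘ (Id 1 ⊗ Mu) ∘ (mu_iter a ⊗ (mu_iter b ⊗ Id 1)))).
  apply: eq_heq; apply: beq_sym.
  apply: beq_trans (Mu_interchange (Id 1) Mu (mu_iter a) (mu_iter b ⊗ Id 1)) _.
  by rewrite comp_idl.
apply: (@heq_trans _ _ _ _ _ _
    (Mu ∘ (Mu ⊗ Id 1) ∘ ((mu_iter a ⊗ mu_iter b) ⊗ Id 1))).
  apply: heq_comp; first exact/eq_heq/beq_sym/mu_assoc.
  exact: (heq_tensA (mu_iter a) (mu_iter b) (Id 1)).
apply: (@heq_trans _ _ _ _ _ _ (Mu ∘ ((Mu ∘ (mu_iter a ⊗ mu_iter b)) ⊗ Id 1))).
  apply: eq_heq.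
  apply: beq_trans (Mu_interchange Mu (Id 1) (mu_iter a ⊗ mu_iter b) (Id 1)) _.
  by rewrite comp_idl.
by apply: heq_comp => //; apply: heq_tens2.
Qed.

Lemma eq_mu_tens q r : q = r -> mu_tens q ≈ mu_tens r.
Proof. by move->. Qed.

Lemma mu_tens_cat q r : mu_tens (q ++ r) ≈ mu_tens q ⊗ mu_tens r.
Proof.
elim: q => [|k q IHq] /=; first exact/heq_sym/heq_Tens0.
apply: (heq_trans _ (heq_tensA (mu_iter k) (mu_tens q) (mu_tens r))).
exact: (heq_tens (heq_refl (mu_iter k)) IHq).
Qed.

Lemma mu_tens_nseq1 n : mu_tens (nseq n 1) ≈ Id n.
Proof.
elim: n => [|n IHn] //=.
exact: heq_trans (heq_tens (heq_refl (Id 1)) IHn) (eq_heq (tens_id 1 n)).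
Qed.

Lemma mu_iter_tens r : mu_iter (size r) ∘ mu_tens r ≈ mu_iter (sumn r).
Proof.
elim: r => [|k r IHr] /=; first exact/eq_heq/comp_idr.
apply: (heq_trans _ (mu_iterD _ _)).
apply: heq_trans (heq_comp (heq_sym (mu_iterD 1 _)) (heq_refl _)) _.
apply: (@heq_trans _ _ _ _ _ _
    (Mu ∘ (mu_iter k ⊗ (mu_iter (size r) ∘ mu_tens r)))).
  apply: eq_heq.
  apply: beq_trans (Mu_interchange (Id 1) (mu_iter (size r)) (mu_iter k) _) _.
  by rewrite comp_idl.
by apply: heq_comp => //; apply: heq_tens2.
Qed.

(** Generalized associativity: cutting [r] into blocks of lengths [q], each
    factor of [mu_tens q] swallows one block. The arrow [f] stands for
    [mu_tens r], whose target is only propositionally [sumn q]. *)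
Lemma mu_tens_comp q r n (f : arrow n (sumn q)) :
  f ≈ mu_tens r -> exists q', mu_tens q ∘ f ≈ mu_tens q'.
Proof.
elim: q r n f => [|k q IHq] r n f fr /=.
  by exists r; apply: heq_trans fr; apply/eq_heq/comp_idl.
have Dr : size r = k + sumn q by case: (heq_dim fr) => _ <-.
have Dk : k = size (take k r) by rewrite size_takel // Dr leq_addr.
have Dq : size (drop k r) = sumn q by rewrite size_drop Dr addKn.
pose f2 := cast erefl Dq (mu_tens (drop k r)).
have [q' Dq'] := IHq (drop k r) _ f2 (heq_cast _ _ _).
exists (sumn (take k r) :: q') => /=.
apply: (@heq_trans _ _ _ _ _ _
  ((mu_iter (size (take k r)) ⊗ mu_tens q) ∘ (mu_tens (take k r) ⊗ f2))).
  apply: heq_comp; first by rewrite -Dk.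
  apply: heq_trans fr (heq_trans (eq_mu_tens (esym (cat_take_drop k r))) _).
  apply: heq_trans (mu_tens_cat _ _) _; apply: heq_tens => //.
  exact/heq_sym/heq_cast.
apply: heq_trans (eq_heq (tens_interchange _ _ _ _)) _.
exact: (heq_tens (mu_iter_tens (take k r)) Dq').
Qed.

(** Naturality of the symmetry: exchanging two adjacent outputs of a tensor
    product of iterated multiplications exchanges two factors, at the cost of a
    permutation of their inputs. *)
Lemma gen_mu_tens i q k n (f : arrow k n) : f ≈ mu_tens q ->
  exists q' (p : arrow k (sumn q')),
    permutative p /\ gen n i ∘ f ≈ mu_tens q' ∘ p.
Proof.
move=> fq; have [Dk Dn] := heq_dim fq.
case: (ltnP i n.-1) => [lti|gei]; last first.
  exists q, (cast erefl Dk (Id k)); split.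
    by apply: permutative_heq (heq_sym (heq_cast _ _ _)) _.
  rewrite /gen insubN -?leqNgt //=.
  apply: heq_trans (eq_heq (comp_idl _)) _.
  apply: (heq_trans (heq_sym (eq_heq (comp_idr _)))).
  by apply: heq_comp => //; apply/heq_sym/(heq_trans (heq_cast _ _ _))/heq_Id.
have [q1 [x [y [q2 [Dq Di]]]]] : exists q1 x y q2,
    q = q1 ++ x :: y :: q2 /\ size q1 = i.
  exists (take i q), (nth 0 q i), (nth 0 q i.+1), (drop i.+2 q); split.
    by rewrite -!drop_nth ?cat_take_drop //; lia.
  by rewrite size_takel; lia.
pose p := Id (sumn q1) ⊗ (Symm x y ⊗ Id (sumn q2)).
have Dp : sumn q1 + (y + x + sumn q2) = sumn (q1 ++ y :: x :: q2).
  by rewrite sumn_cat /= !addnA.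
have Dk' : sumn q1 + (x + y + sumn q2) = k.
  by rewrite Dk Dq sumn_cat /= !addnA.
have split2 a b : mu_tens (q1 ++ a :: b :: q2) ≈
    mu_tens q1 ⊗ ((mu_iter a ⊗ mu_iter b) ⊗ mu_tens q2).
  apply: heq_trans (mu_tens_cat _ _) _; apply: heq_tens => //=.
  exact: (heq_tensA (mu_iter a) (mu_iter b) (mu_tens q2)).
exists (q1 ++ y :: x :: q2), (cast Dk' Dp p); split.
  apply: permutative_heq (heq_sym (heq_cast _ _ _)) _.
  by apply: permutative_whisker; exact: permutative_Symm.
apply: (@heq_trans _ _ _ _ _ _ (whisker (size q1) (size q2) P11 ∘
   (mu_tens q1 ⊗ ((mu_iter x ⊗ mu_iter y) ⊗ mu_tens q2)))).
  apply: heq_comp.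
    apply: (@gen_whisker _ _ _ _ _ 0 0); rewrite ?addn0 //.
      by rewrite Dn Dq size_cat.
    exact: heq_sym (heq_trans (heq_Tens0 _) (heq_tens0 _)).
  apply: heq_trans fq (heq_trans (eq_mu_tens Dq) _); exact: split2.
apply: (@heq_trans _ _ _ _ _ _
   ((mu_tens q1 ⊗ ((mu_iter y ⊗ mu_iter x) ⊗ mu_tens q2)) ∘ p)); last first.
  by apply: heq_comp; apply: heq_sym; [exact: split2 | exact: heq_cast].
apply/eq_heq; rewrite /whisker /p.
apply: beq_trans (tens_interchange _ _ _ _) _.
apply: beq_trans (beq_sym (tens_interchange _ _ _ _)).
apply: beq_tens; first by rewrite comp_idl comp_idr.
apply: beq_trans (tens_interchange P11 (mu_iter x ⊗ mu_iter y) _ _) _.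
apply: beq_trans (beq_sym (tens_interchange (mu_iter y ⊗ mu_iter x) _ _ _)).
apply: beq_tens; last by rewrite comp_idl comp_idr.
exact: sym_natural.
Qed.

Lemma gens_mu_tens w q k n (f : arrow k n) : f ≈ mu_tens q ->
  exists q' (p : arrow k (sumn q')),
    permutative p /\ gens n w ∘ f ≈ mu_tens q' ∘ p.
Proof.
elim: w q k f => [|i w IHw] q k f fq /=.
  have [q' [p [Pp Dp]]] := gen_mu_tens n fq.
  exists q', p; split=> //; apply: (heq_trans _ Dp).
  rewrite /gen insubN //= -leqNgt; exact: leq_pred.
have [q1 [p1 [Pp1 Dp1]]] := gen_mu_tens i fq.
have Dn : size q1 = n by case: (heq_dim Dp1).
pose h := cast erefl Dn (mu_tens q1).
have [q2 [p2 [Pp2 Dp2]]] := IHw q1 _ h (heq_cast _ _ _).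
exists q2, (p2 ∘ p1); split; first exact: permutative_comp.
apply: (@heq_trans _ _ _ _ _ _ (gens n w ∘ (h ∘ p1))).
  apply: heq_trans (eq_heq (beq_sym (comp_assoc _ _ _))) _.
  apply: heq_comp => //; apply: (heq_trans Dp1).
  by apply: heq_comp => //; exact/heq_sym/heq_cast.
apply: heq_trans (eq_heq (comp_assoc _ _ _)) _.
apply: heq_trans (heq_comp Dp2 (heq_refl _)) _.
exact/eq_heq/beq_sym/comp_assoc.
Qed.

(** * Composites of multiplications and permutations *)

(** Normal form of the arrows built from [Mu], [Eta] and symmetries. *)
Definition algebraic n m (f : arrow n m) :=
  exists q (p : arrow n (sumn q)), permutative p /\ f ≈ mu_tens q ∘ p.

Lemma algebraic_heq n m n' m' (f : arrow n m) (g : arrow n' m') :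
  f ≈ g -> algebraic f -> algebraic g.
Proof.
case=> en [em]; subst n' m'; rewrite cast_id => fg [q [p [Pp fp]]].
by exists q, p; split=> //; apply: heq_transl (eq_heq fg) fp.
Qed.

Lemma algebraic_mu_tens q : algebraic (mu_tens q).
Proof. by exists q, (Id _); split=> //; apply/eq_heq/beq_sym/comp_idr. Qed.

Lemma algebraic_Mu : algebraic Mu.
Proof.
apply: algebraic_heq (algebraic_mu_tens [:: 2]).
apply: heq_trans (heq_tens0 (mu_iter 2)) (heq_trans (mu_iterS 1) (eq_heq _)).
by apply: beq_trans (beq_comp (beq_refl Mu) (tens_id 1 1)) (comp_idr _).
Qed.

Lemma algebraic_Eta : algebraic Eta.
Proof. exact: algebraic_heq (heq_tens0 Eta) (algebraic_mu_tens [:: 0]). Qed.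

(** The permutation in the middle of the composite slides to the source by
    naturality, and the two layers of multiplications merge. *)
Lemma algebraic_comp n m k (g : arrow m k) (f : arrow n m) :
  algebraic g -> algebraic f -> algebraic (g ∘ f).
Proof.
case=> [q [p [Pp gp]]] [r [p' [Pp' fp']]].
have Dm := permutative_dim Pp; subst m; case: Pp => w pw.
have [_ Dr] := heq_dim fp'; pose h' := cast erefl (esym Dr) (mu_tens r).
have hr : h' ≈ mu_tens r by apply: heq_cast.
have [r1 [p1 [Pp1 Dp1]]] := gens_mu_tens w hr.
have [_ Dr1] := heq_dim Dp1; pose h := cast erefl (esym Dr1) (mu_tens r1).
have hr1 : h ≈ mu_tens r1 by apply: heq_cast.
have [q2 Dq2] := mu_tens_comp hr1; have [D2 _] := heq_dim Dq2.
exists q2, (cast erefl D2 p1 ∘ p'); split.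
  apply: permutative_comp Pp'; apply: permutative_heq Pp1; exact/heq_sym/heq_cast.
apply: (@heq_trans _ _ _ _ _ _ (mu_tens q ∘ (p ∘ (h' ∘ p')))).
  apply: (heq_trans _ (eq_heq (beq_sym (comp_assoc _ _ _)))).
  apply: (heq_comp gp); apply: (heq_trans fp').
  by apply: heq_comp => //; exact: heq_sym.
apply: (@heq_trans _ _ _ _ _ _ (mu_tens q ∘ (h ∘ p1 ∘ p'))).
  apply: heq_comp => //; apply: heq_trans (eq_heq (comp_assoc _ _ _)) _.
  apply: heq_comp => //; apply: heq_trans (heq_comp pw (heq_refl _)) _.
  by apply: heq_trans Dp1 _; apply: heq_comp => //; exact: heq_sym.
apply: (@heq_trans _ _ _ _ _ _ (mu_tens q ∘ h ∘ (p1 ∘ p'))).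
  by apply: eq_heq; rewrite !comp_assoc.
by do 2!apply: heq_comp => //; apply/heq_sym/heq_cast.
Qed.

(** The identity is the tensor product of the [mu_iter 1]. *)
Lemma permutative_algebraic n m (f : arrow n m) : permutative f -> algebraic f.
Proof.
move=> Pf; have Dm := permutative_dim Pf; subst m.
have Ds : n = sumn (nseq n 1) by rewrite sumn_nseq mul1n.
exists (nseq n 1), (cast erefl Ds f); split.
  by apply: permutative_heq Pf; exact/heq_sym/heq_cast.
apply: (heq_trans (heq_sym (eq_heq (comp_idl f)))).
by apply: heq_comp; apply: heq_sym; [exact: mu_tens_nseq1 | exact: heq_cast].
Qed.

Lemma algebraic_tens n m n' m' (f : arrow n m) (g : arrow n' m') :
  algebraic f -> algebraic g -> algebraic (f ⊗ g).
Proof.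
case=> [q [p [Pp fp]]] [r [p' [Pp' gp']]].
exists (q ++ r), (cast erefl (esym (sumn_cat q r)) (p ⊗ p')); split.
  apply: permutative_heq (permutative_tens Pp Pp'); exact/heq_sym/heq_cast.
apply: heq_trans (heq_tens fp gp') _.
apply: heq_trans (eq_heq (beq_sym (tens_interchange _ _ _ _))) _.
apply: heq_comp; apply: heq_sym; [exact: mu_tens_cat | exact: heq_cast].
Qed.

(** * Duality *)

(** Reflection in a horizontal axis: the bialgebra relations are self-dual, so
    each statement on multiplications gives one on comultiplications. *)
Fixpoint op n m (f : arrow n m) : arrow m n :=
  match f with
  | Id n => Id n
  | Comp n m k g f => op f ∘ op g
  | Tens n m n' m' f g => op f ⊗ op g
  | Symm n m => Symm m n
  | Mu => Delta
  | Eta => Eps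
  | Delta => Mu
  | Eps => Eta
  end.

Lemma opK n m (f : arrow n m) : op (op f) = f.
Proof. by elim: f => //= [n' m' k g -> f -> | n1 m1 n2 m2 f -> g ->]. Qed.

Lemma op_cast n m n' m' (en : n = n') (em : m = m') (f : arrow n m) :
  op (cast en em f) = cast em en (op f).
Proof. by subst n' m'. Qed.

(** The hexagon for the inverse symmetries, obtained by inverting both sides. *)
Lemma sym_hexagon_op n m k :
  cast (esym (addnA m k n)) (addnA n m k) (Symm (m + k) n) ≡
  cast (esym (addnA m n k)) erefl (Symm m n ⊗ Id k) ∘ (Id m ⊗ Symm k n).
Proof.
pose b := cast erefl (esym (addnA m n k)) (Symm n m ⊗ Id k).
pose b' := cast (esym (addnA m n k)) erefl (Symm m n ⊗ Id k).
have b'b : b' ∘ b ≡ Id _.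
  apply: heqE; apply: heq_trans (heq_comp (heq_cast _ _ _) (heq_cast _ _ _)) _.
  by apply: eq_heq; rewrite tens_interchange sym_invol comp_idl tens_id.
(* A one-sided inverse of a symmetry is the opposite symmetry. *)
pose g := cast (addnA m k n) (esym (addnA n m k)) (b' ∘ (Id m ⊗ Symm k n)).
suff gS : g ∘ Symm n (m + k) ≡ Id _.
  apply: heqE; apply: heq_trans (heq_cast _ _ _) _.
  by apply: heq_trans (eq_heq (Symm_inv gS)) _; exact: heq_cast.
have hex : Symm n (m + k) ≈ (Id m ⊗ Symm n k) ∘ b.
  apply: heq_trans (heq_sym (heq_cast (addnA n m k) (esym (addnA m k n)) _)) _.
  exact/eq_heq/sym_hexagon.
apply: heqE; apply: heq_trans (heq_comp (heq_cast _ _ _) hex) _.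
apply: (@heq_trans _ _ _ _ _ _ (Id (n + m + k))); last exact/heq_Id/esym/addnA.
apply: eq_heq; rewrite comp_assoc -[_ ∘ _ ∘ (Id m ⊗ _)]comp_assoc.
by rewrite tens_interchange sym_invol comp_idl tens_id comp_idr.
Qed.

Lemma op_beq n m (f g : arrow n m) : f ≡ g -> op f ≡ op g.
Proof.
elim=> {n m f g} /=.
- by move=> *; exact: beq_refl.
- by move=> n m f g _ fg; exact: beq_sym.
- by move=> n m f g h _ fg _; exact: beq_trans.
- by move=> n m k g g' f f' _ gg' _ ff'; exact: beq_comp.
- by move=> n m n' m' f g f' g' _ fg _ fg'; exact: beq_tens.
- by move=> n m f; exact: comp_idr.
- by move=> n m f; exact: comp_idl.
- by move=> n m k l h g f; exact/beq_sym/comp_assoc.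
- exact: tens_id.
- by move=> *; exact: tens_interchange.
- by move=> n m n' m' n'' m'' f f' f''; rewrite op_cast; exact: tens_assoc.
- by move=> n m f; exact: tens_unitl.
- by move=> n m f; rewrite op_cast; exact: tens_unitr.
- by move=> n m n' m' f f'; apply/beq_sym/sym_natural.
- by move=> n m; exact: sym_invol.
- by move=> n m k; rewrite !op_cast; exact: sym_hexagon_op.
- exact: delta_coassoc.
- exact: delta_counitr.
- exact: delta_counitl.
- exact: mu_assoc.
- exact: mu_unitr.
- exact: mu_unitl.
- by rewrite comp_assoc; exact: delta_mu.
- exact: eps_mu.
- exact: delta_eta.
- exact: eps_eta.
Qed.

Lemma heq_op n m n' m' (f : arrow n m) (g : arrow n' m') : f ≈ g -> op f ≈ op g.
Proof.
by case=> en [em]; subst n' m'; rewrite cast_id => fg; exact/eq_heq/op_beq.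
Qed.

Lemma op_mu_iter k : op (mu_iter k) = delta_iter k.
Proof.
elim: k => // -[|k] // IHk.
rewrite -[mu_iter k.+2]/(cast (addn1 _) erefl (Mu ∘ (mu_iter k.+1 ⊗ Id 1))).
by rewrite op_cast -[op (_ ∘ _)]/((op (mu_iter k.+1) ⊗ Id 1) ∘ Delta) IHk.
Qed.

Lemma op_mu_tens q : op (mu_tens q) = delta_tens q.
Proof. by elim: q => //= k q ->; rewrite op_mu_iter. Qed.

Lemma permutative_op n m (f : arrow n m) : permutative f -> permutative (op f).
Proof.
move=> Pf; have Dm := permutative_dim Pf; subst m; case: Pf => w fw.
apply: (permutative_heq (heq_sym (heq_op fw))) => {f fw}.
elim: w => //= i w IHw; apply: permutative_comp => //.
rewrite /gen; case: insubP => //= k _ _; rewrite op_cast /=.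
apply: permutative_heq (heq_sym (heq_cast _ _ _)) _.
exact: (permutative_whisker k _ (permutative_Symm 1 1)).
Qed.

Definition coalgebraic n m (f : arrow n m) := algebraic (op f).

Lemma coalgebraic_normal n m (f : arrow n m) : coalgebraic f ->
  exists r (p : arrow (sumn r) m), permutative p /\ f ≈ p ∘ delta_tens r.
Proof.
case=> r [p [Pp fp]]; exists r, (op p); split; first exact: permutative_op.
by rewrite -(opK f) -op_mu_tens; exact: (heq_op fp).
Qed.

Lemma coalgebraic_comp n m k (g : arrow m k) (f : arrow n m) :
  coalgebraic g -> coalgebraic f -> coalgebraic (g ∘ f).
Proof. by move=> Eg Ef; exact: algebraic_comp. Qed.

Lemma coalgebraic_tens n m n' m' (f : arrow n m) (g : arrow n' m') :
  coalgebraic f -> coalgebraic g -> coalgebraic (f ⊗ g).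
Proof. exact: algebraic_tens. Qed.

Lemma permutative_coalgebraic n m (f : arrow n m) : permutative f -> coalgebraic f.
Proof. by move=> /permutative_op; exact: permutative_algebraic. Qed.

Lemma delta_iterS k : delta_iter k.+1 ≈ (delta_iter k ⊗ Id 1) ∘ Delta.
Proof. by rewrite -!op_mu_iter; exact: (heq_op (mu_iterS k)). Qed.

(** * Exchanging multiplications and comultiplications *)

Definition separated n m (f : arrow n m) :=
  exists k (g : arrow k m) (h : arrow n k),
    [/\ algebraic g, coalgebraic h & f ≈ g ∘ h].

Lemma separated_heq n m n' m' (f : arrow n m) (g : arrow n' m') :
  f ≈ g -> separated f -> separated g.
Proof.
case=> en [em]; subst n' m'; rewrite cast_id => fg [k [g' [h [Mg Eh fgh]]]].
by exists k, g', h; split=> //; apply: heq_transl (eq_heq fg) fgh.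
Qed.

Lemma algebraic_separated n m (f : arrow n m) : algebraic f -> separated f.
Proof.
move=> Mf; exists n, f, (Id n); split=> //.
  by apply: permutative_coalgebraic.
exact/eq_heq/beq_sym/comp_idr.
Qed.

Lemma coalgebraic_separated n m (f : arrow n m) : coalgebraic f -> separated f.
Proof.
move=> Ef; exists m, (Id m), f; split=> //.
  by apply: permutative_algebraic.
exact/eq_heq/beq_sym/comp_idl.
Qed.

Lemma separated_compl n m k (g : arrow m k) (f : arrow n m) :
  algebraic g -> separated f -> separated (g ∘ f).
Proof.
move=> Mg [l [g' [h [Mg' Eh /heqE fgh]]]]; exists l, (g ∘ g'), h; split=> //.
  exact: algebraic_comp.
by apply: eq_heq; rewrite fgh comp_assoc.
Qed.

Lemma separated_compr n m k (g : arrow m k) (f : arrow n m) :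
  separated g -> coalgebraic f -> separated (g ∘ f).
Proof.
move=> [l [g' [h [Mg' Eh /heqE fgh]]]] Ef; exists l, g', (h ∘ f); split=> //.
  exact: coalgebraic_comp.
by apply: eq_heq; rewrite fgh comp_assoc.
Qed.

Lemma separated_tens n m n' m' (f : arrow n m) (g : arrow n' m') :
  separated f -> separated g -> separated (f ⊗ g).
Proof.
move=> [k [f1 [f2 [Mf Ef /heqE Df]]]] [k' [g1 [g2 [Mg Eg /heqE Dg]]]].
exists (k + k'), (f1 ⊗ g1), (f2 ⊗ g2); split; first exact: algebraic_tens.
  exact: coalgebraic_tens.
by apply: eq_heq; rewrite Df Dg tens_interchange.
Qed.

(** Grouplikeness of the unit turns the composite into a product of units. *)
Lemma delta_iter_Eta k : separated (delta_iter k ∘ Eta).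
Proof.
elim: k => [|k IHk].
  apply: separated_heq (heq_sym (eq_heq eps_eta)) _.
  by apply/algebraic_separated/permutative_algebraic.
apply: (@separated_heq _ _ _ _ ((delta_iter k ∘ Eta) ⊗ Eta)); last first.
  by apply: separated_tens => //; apply/algebraic_separated/algebraic_Eta.
apply: (@heq_trans _ _ _ _ _ _ ((delta_iter k ⊗ Id 1) ∘ Delta ∘ Eta)); last first.
  by apply: heq_comp => //; exact/heq_sym/delta_iterS.
apply: eq_heq; rewrite -comp_assoc delta_eta.
by rewrite (tens_interchange (delta_iter k) Eta (Id 1) Eta) comp_idl.
Qed.

(** After the bialgebra law, the [delta_iter k] that remains of
    [delta_iter k.+1] again faces a single [Mu], so the induction closes. *)
Lemma delta_iter_Mu k : separated (delta_iter k ∘ Mu).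
Proof.
have Emid : coalgebraic ((Id 1 ⊗ P11 ⊗ Id 1) ∘ (Delta ⊗ Delta)).
  apply: coalgebraic_comp.
  2: exact: (@coalgebraic_tens 1 2 1 2 Delta Delta algebraic_Mu algebraic_Mu).
  apply: permutative_coalgebraic.
  apply: (permutative_tens (permutative_tens _ (permutative_Symm 1 1)));
    exact: permutative_Id.
elim: k => [|k IHk].
  apply: separated_heq (heq_sym (eq_heq eps_mu)) _.
  apply/coalgebraic_separated.
  exact: (@coalgebraic_tens 1 0 1 0 Eps Eps algebraic_Eta algebraic_Eta).
apply: (@separated_heq _ _ _ _ (((delta_iter k ∘ Mu) ⊗ Mu) ∘
    ((Id 1 ⊗ P11 ⊗ Id 1) ∘ (Delta ⊗ Delta)))); last first.
  apply: (@separated_compr 2 4) => //.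
  exact: (@separated_tens 2 k 2 1 _ Mu IHk (algebraic_separated algebraic_Mu)).
apply: (@heq_trans _ _ _ _ _ _ ((delta_iter k ⊗ Id 1) ∘ Delta ∘ Mu)); last first.
  by apply: heq_comp => //; exact/heq_sym/delta_iterS.
apply/eq_heq/beq_sym; rewrite -comp_assoc delta_mu.
rewrite -(comp_assoc (Mu ⊗ Mu)) (comp_assoc (delta_iter k ⊗ Id 1)).
apply: (@beq_comp 2 4 (k + 1)) => //.
by rewrite (tens_interchange (delta_iter k) Mu (Id 1) Mu) comp_idl.
Qed.

(** Moving [delta_iter k] past the last [Mu] leaves a coalgebraic arrow with two
    inputs, that is a permutation after some [delta_iter a ⊗ delta_iter b];
    hence the induction on [j] has to be uniform in [k]. *)
Lemma delta_iter_mu_iter k j : separated (delta_iter k ∘ mu_iter j).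
Proof.
elim: j k => [|j IHj] k; first exact: delta_iter_Eta.
have [l [g [h [Mg Eh /heqE Dgh]]]] := delta_iter_Mu k.
apply: (@separated_heq _ _ _ _ (g ∘ (h ∘ (mu_iter j ⊗ Id 1)))).
  apply: (@heq_trans _ _ _ _ _ _ (delta_iter k ∘ (Mu ∘ (mu_iter j ⊗ Id 1)))).
    by apply: eq_heq; rewrite !comp_assoc Dgh.
  by apply: heq_comp => //; exact/heq_sym/mu_iterS.
apply: separated_compl => //.
have [r [p [Pp hp]]] := coalgebraic_normal Eh.
have [Dr _] := heq_dim hp.
case: r p Pp hp Dr => [|a [|b []]] //= p Pp hp _.
have Dp : sumn [:: a; b] = a + b by rewrite /= addn0.
pose p' := cast Dp erefl p.
have hp' : h ≡ p' ∘ (delta_iter a ⊗ delta_iter b).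
  apply: heqE; apply: (heq_trans hp); apply: heq_comp.
    exact/heq_sym/heq_cast.
  apply: heq_trans (heq_tensA (delta_iter a) (delta_iter b) (Id 0)) _.
  exact: (heq_tens0 (delta_iter a ⊗ delta_iter b)).
apply: (@separated_heq _ _ _ _
    (p' ∘ ((delta_iter a ∘ mu_iter j) ⊗ delta_iter b))).
  apply: eq_heq; rewrite hp' -comp_assoc; apply: beq_comp => //.
  rewrite (tens_interchange (delta_iter a) (mu_iter j) (delta_iter b) (Id 1)).
  by rewrite comp_idr.
apply: separated_compl.
  by apply: permutative_algebraic; apply: permutative_heq Pp; exact/heq_sym/heq_cast.
apply: separated_tens => //; apply: coalgebraic_separated.
rewrite /coalgebraic -op_mu_iter opK.
exact: algebraic_heq (heq_tens0 (mu_iter b)) (algebraic_mu_tens [:: b]).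
Qed.

Lemma delta_tens_mu_tens r q n (f : arrow n (size r)) :
  f ≈ mu_tens q -> separated (delta_tens r ∘ f).
Proof.
elim: r q n f => [|k r IHr] q n f fq; have [_ Dq] := heq_dim fq.
  apply: (separated_heq (heq_sym (eq_heq (comp_idl f)))).
  apply/algebraic_separated/(algebraic_heq (heq_sym fq)); exact: algebraic_mu_tens.
case: q fq Dq => //= j q fq [Dq].
pose f2 := cast erefl (esym Dq) (mu_tens q).
have f2q : f2 ≈ mu_tens q by apply: heq_cast.
apply: (@separated_heq _ _ _ _
    ((delta_iter k ∘ mu_iter j) ⊗ (delta_tens r ∘ f2))).
  apply: (@heq_trans _ _ _ _ _ _
    ((delta_iter k ⊗ delta_tens r) ∘ (mu_iter j ⊗ f2))).
    by apply/eq_heq/beq_sym/tens_interchange.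
  apply: heq_comp => //; apply: (heq_trans _ (heq_sym fq)).
  exact: (heq_tens (heq_refl (mu_iter j)) f2q).
by apply: separated_tens; [exact: delta_iter_mu_iter | exact: IHr f2q].
Qed.

Lemma separated_comp n m k (g : arrow m k) (f : arrow n m) :
  separated g -> separated f -> separated (g ∘ f).
Proof.
move=> [l [g1 [g2 [Mg1 Eg2 /heqE Dg]]]] [l' [f1 [f2 [Mf1 Ef2 /heqE Df]]]].
apply: (@separated_heq _ _ _ _ (g1 ∘ (g2 ∘ f1 ∘ f2))).
  by apply: eq_heq; rewrite Dg Df !comp_assoc.
apply: separated_compl => //; apply: separated_compr => //.
move=> {n k f g g1 f2 Mg1 Dg Ef2 Df}.
have [r [p [Pp Dp]]] := coalgebraic_normal Eg2.
have [q [p' [Pp' Dp']]] := Mf1.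
have [Dm _] := heq_dim Dp; subst m; have [_ Dq] := heq_dim Dp'.
pose h := cast erefl (esym Dq) (mu_tens q).
have hq : h ≈ mu_tens q by apply: heq_cast.
apply: (@separated_heq _ _ _ _ (p ∘ (delta_tens r ∘ h ∘ p'))).
  apply: (@heq_trans _ _ _ _ _ _ (p ∘ delta_tens r ∘ (h ∘ p'))).
    by apply: eq_heq; rewrite !comp_assoc.
  apply: heq_sym; apply: (heq_comp Dp); apply: (heq_trans Dp').
  by apply: heq_comp => //; exact: heq_sym.
apply: separated_compl; first exact: permutative_algebraic.
apply: separated_compr; first exact: delta_tens_mu_tens hq.
exact: permutative_coalgebraic.
Qed.

Lemma all_separated n m (f : arrow n m) : separated f.
Proof.
elim: f => {n m}.
- by move=> n; apply/algebraic_separated/permutative_algebraic.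
- by move=> n m k g Bg f Bf; exact: separated_comp.
- by move=> n m n' m' f Bf g Bg; exact: separated_tens.
- by move=> n m; apply/algebraic_separated/permutative_algebraic/permutative_Symm.
- exact/algebraic_separated/algebraic_Mu.
- exact/algebraic_separated/algebraic_Eta.
- exact/coalgebraic_separated/algebraic_Mu.
- exact/coalgebraic_separated/algebraic_Eta.
Qed.

Lemma factorization_exists n m (f : arrow n m) :
  exists d : factorization n m, f ≡ fact_arrow d.
Proof.
have [k [g [h [[q [p [Pp Dp]]] Eh Df]]]] := all_separated f.
have [r [p' [Pp' Dp']]] := coalgebraic_normal Eh.
have Dk := permutative_dim Pp; have Dk' := permutative_dim Pp'.
have [_ Dm] := heq_dim Dp; have [Dn _] := heq_dim Dp'.
have Ds : sumn r = sumn q by rewrite Dk Dk'.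
pose pp := cast erefl (esym Ds) (p ∘ p').
have [x Dx] : exists x, pp ≡ perm_arrow x.
  apply/permutative_perm_arrow/(@permutative_heq _ _ _ _ (p ∘ p')).
    exact/heq_sym/heq_cast.
  exact: permutative_comp.
have Tr : size r == n by rewrite Dn.
have Tq : size q == m by rewrite Dm.
exists (@Factorization n m (Tuple Tr) (Tuple Tq) Ds x).
apply: heqE; apply/heq_sym/(heq_trans (heq_cast _ _ _)) => /=.
apply: (@heq_trans _ _ _ _ _ _ (mu_tens q ∘ p ∘ (p' ∘ delta_tens r))); last first.
  by apply: (heq_trans _ (heq_sym Df)); apply: heq_comp; exact: heq_sym.
apply: (@heq_trans _ _ _ _ _ _ (mu_tens q ∘ (p ∘ p') ∘ delta_tens r)); last first.
  by apply: eq_heq; rewrite !comp_assoc.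
do 2!apply: heq_comp => //; apply: heq_trans (heq_cast _ _ _) _.
exact: heq_trans (heq_sym (eq_heq Dx)) (heq_cast _ _ _).
Qed.

(** * A faithful relational model *)

(** An object [n] is interpreted by the lists of [n] words. The lists are cut
    with [take] and [drop], so that no existential quantifier is needed for
    [Tens]; the lengths come out right by [sem_size]. A letter (a, b) is a
    matrix unit, and a word is comultiplied letterwise. *)
Notation word := (seq (nat * nat)).

Fixpoint sem n m (f : arrow n m) (x y : seq word) : Prop :=
  match f with
  | Id n => size x = n /\ y = x
  | Comp n m k g f => exists2 z, sem f x z & sem g z y
  | Tens n m n' m' f g =>
      sem f (take n x) (take m y) /\ sem g (drop n x) (drop m y)
  | Symm n m => size x = n + m /\ y = drop n x ++ take n x
  | Mu => exists u v, x = [:: u; v] /\ y = [:: u ++ v]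
  | Eta => x = [::] /\ y = [:: [::]]
  | Delta => exists u v w, [/\ x = [:: w], y = [:: u; v] &
      [/\ unzip1 w = unzip1 u, unzip2 u = unzip1 v & unzip2 v = unzip2 w]]
  | Eps => exists2 w, x = [:: w] /\ y = [::] & unzip1 w = unzip2 w
  end.

Lemma size_take_drop T n n' (x : seq T) :
  size (take n x) = n -> size (drop n x) = n' -> size x = n + n'.
Proof. by move=> Dn Dn'; rewrite -(cat_take_drop n x) size_cat Dn Dn'. Qed.

Lemma sem_size n m (f : arrow n m) x y : sem f x y -> size x = n /\ size y = m.
Proof.
elim: f x y => {n m} /=.
- by move=> n x y [<- ->].
- by move=> n m k g IHg f IHf x y [z /IHf[<- _] /IHg[_ <-]].
- move=> n m n' m' f IHf g IHg x y [/IHf[xn ym] /IHg[xn' ym']].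
  by split; exact: size_take_drop.
- by move=> n m x y [Dx ->]; rewrite -/(rot n x) size_rot [m + n]addnC.
- by move=> x y [u [v [-> ->]]].
- by move=> x y [-> ->].
- by move=> x y [u [v [w [-> -> _]]]].
- by move=> x y [w [-> ->]].
Qed.

Lemma sem_cast n m n' m' (en : n = n') (em : m = m') (f : arrow n m) :
  sem (cast en em f) = sem f.
Proof. by subst n' m'. Qed.

Lemma sem_hexagon n m k x y :
  sem (cast (addnA n m k) (esym (addnA m k n)) (Symm n (m + k))) x y <->
  sem ((Id m ⊗ Symm n k) ∘ cast erefl (esym (addnA m n k)) (Symm n m ⊗ Id k)) x y.
Proof.
have cut : size x = n + m + k -> exists a b c,
    [/\ x = a ++ b ++ c, size a = n, size b = m & size c = k].
  move=> Dx; exists (take n x), (take m (drop n x)), (drop (n + m) x).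
  have len : n <= size x by lia.
  have lem : m <= size (drop n x) by rewrite size_drop; lia.
  rewrite addnC -drop_drop !cat_take_drop !size_takel // !size_drop; split=> //; lia.
have cat2 l (u v : seq word) : size u = l ->
    (take l (u ++ v) = u) * (drop l (u ++ v) = v).
  by move=> Du; rewrite take_size_cat // drop_size_cat.
rewrite sem_cast /= sem_cast /=; split.
  case=> Dx ->; have {Dx}/cut[a [b [c [-> Da Db Dc]]]] : size x = n + m + k.
    by rewrite Dx addnA.
  have Dab : size (a ++ b) = n + m by rewrite size_cat Da Db.
  have Dba : size (b ++ a) = m + n by rewrite size_cat Da Db.
  rewrite (cat2 _ _ (b ++ c) Da).
  exists (b ++ a ++ c).
    by rewrite !catA !(cat2 _ _ _ Dab) !(cat2 _ _ _ Dba) !(cat2 _ _ _ Da).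
  rewrite -!catA !(cat2 _ _ _ Db) !(cat2 _ _ _ Da).
  by rewrite size_cat Da Dc.
case=> z [[Dnm z1] [Dk z2]] [[Dm y1] [Dnk y2]].
have /cut[a [b [c [Dx Da Db Dc]]]] := size_take_drop Dnm Dk.
have Dab : size (a ++ b) = n + m by rewrite size_cat Da Db.
have Dz : z = b ++ a ++ c.
  rewrite -[z](cat_take_drop (m + n)) z1 z2 Dx catA.
  by rewrite !(cat2 _ _ _ Dab) !(cat2 _ _ _ Da) -catA.
split; first by rewrite Dx !size_cat Da Db Dc.
rewrite -[LHS](cat_take_drop m) y1 y2 Dz Dx.
by rewrite !(cat2 _ _ _ Db) !(cat2 _ _ _ Da) catA.
Qed.

Lemma word_exists (s t : seq nat) : size s = size t ->
  exists2 w : word, unzip1 w = s & unzip2 w = t.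
Proof. by move=> st; exists (zip s t); rewrite ?unzip1_zip ?unzip2_zip ?st. Qed.

Lemma word_inj (w w' : word) : unzip1 w = unzip1 w' -> unzip2 w = unzip2 w' -> w = w'.
Proof. by move=> e1 e2; rewrite -[w]zip_unzip e1 e2 zip_unzip. Qed.

Lemma size_unzip12 (u v : word) : unzip2 u = unzip1 v -> size u = size v.
Proof. by move/(congr1 size); rewrite !size_map. Qed.

(** The next lemmas say that words form a bialgebra. *)
Lemma sem_mu_assoc x y :
  sem (Mu ∘ (Mu ⊗ Id 1)) x y <-> sem (Mu ∘ (Id 1 ⊗ Mu)) x y.
Proof.
split=> xy; have [] := sem_size xy; case: x xy => [|a [|b [|c []]]] //= [z].
  move=> [[u [v [[<- <-] ez]]] [_ ez']] [u' [v' [Dz ->]]] _ _; subst z.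
  move: ez ez' => /= [->] [->]; exists [:: a; b ++ c] => /=.
    by split=> //; exists b, c.
  by exists a, (b ++ c); rewrite catA.
move=> [[_ ez] [u [v [[<- <-] ez']]]] [u' [v' [Dz ->]]] _ _; subst z.
case: ez => ->; case: ez' => ->; exists [:: a ++ b; c] => /=.
  by split=> //; exists a, b.
by exists (a ++ b), c; rewrite catA.
Qed.

Lemma sem_mu_unitr x y : sem (Mu ∘ (Id 1 ⊗ Eta)) x y <-> sem (Id 1) x y.
Proof.
split=> xy; have [] := sem_size xy; case: x xy => [|a []] //=.
  case=> z [[_ ez] [_ ez']] [u [v [Dz ->]]] _ _; subst z.
  by move: ez ez' => /= [->] [->]; rewrite cats0.
case=> _ -> _ _; exists [:: a; [::]] => //.
by exists a, [::]; rewrite cats0.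
Qed.

Lemma sem_mu_unitl x y : sem (Mu ∘ (Eta ⊗ Id 1)) x y <-> sem (Id 1) x y.
Proof.
split=> xy; have [] := sem_size xy; case: x xy => [|a []] //=.
  case=> z [[_ ez] [_ ez']] [u [v [Dz ->]]] _ _; subst z.
  by move: ez ez' => /= [->] [->].
case=> _ -> _ _; exists [:: [::]; a] => //.
by exists [::], a.
Qed.

Lemma sem_delta_coassoc x y :
  sem ((Delta ⊗ Id 1) ∘ Delta) x y <-> sem ((Id 1 ⊗ Delta) ∘ Delta) x y.
Proof.
split=> xy; have [] := sem_size xy; case: y xy => [|a [|b [|c []]]] //= [z].
  move=> [u [v [w [-> -> [wu uv vw]]]]] /= [[a' [b' [_ [[<-] [<- <-]]]]]].
  move=> [ua ab bu] [_ [Dv]] _ _; subst v.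
  have [t t1 t2] : exists2 t : word, unzip1 t = unzip1 b & unzip2 t = unzip2 c.
    by apply: word_exists; rewrite !size_map; apply: size_unzip12; rewrite bu.
  exists [:: a; t] => /=; last by split=> //; exists b, c, t; rewrite bu.
  by exists a, t, w; rewrite t1 t2 -ua.
move=> [u [v [w [-> -> [wu uv vw]]]]] /= [[_ [Da]]].
move=> [b' [c' [_ [[<-] [<- <-] [vb bc cv]]]]] _ _; subst u.
have [t t1 t2] : exists2 t : word, unzip1 t = unzip1 a & unzip2 t = unzip2 b.
  apply: word_exists; rewrite !size_map; apply: size_unzip12.
  by rewrite uv vb.
exists [:: t; c] => /=; last by split=> //; exists a, b, t; rewrite -vb.
by exists t, c, w; rewrite t1 t2 cv.
Qed.

Lemma sem_delta_counitr x y : sem ((Id 1 ⊗ Eps) ∘ Delta) x y <-> sem (Id 1) x y.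
Proof.
split=> /=.
  move=> [z [u [v [w [-> -> [wu uv vw]]]]]].
  move=> [[_ e1] [w' [[<-] e2] e]]; rewrite -[y](cat_take_drop 1) e1 e2.
  by split=> //; congr [:: _]; apply: word_inj; rewrite // -vw -e.
case=> Dx ->; case: x Dx => [|w []] // _.
have [v v1 v2] := @word_exists (unzip2 w) (unzip2 w) erefl.
exists [:: w; v]; first by exists w, v, w.
by split=> //; exists v; rewrite ?v1.
Qed.

Lemma sem_delta_counitl x y : sem ((Eps ⊗ Id 1) ∘ Delta) x y <-> sem (Id 1) x y.
Proof.
split=> /=.
  move=> [z [u [v [w [-> -> [wu uv vw]]]]]].
  rewrite take0 drop0 /= => -[[w' [[<-] _]] e [_ ->]]; split=> //; congr [:: _].
  by apply: word_inj => //; rewrite -uv -e.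
case=> Dx ->; case: x Dx => [|w []] // _.
have [v v1 v2] := @word_exists (unzip1 w) (unzip1 w) erefl.
exists [:: v; w]; first by exists v, w, w.
by split=> //; exists v; rewrite ?v1.
Qed.

(** A comultiplication of [a ++ b] splits at [size a], as comultiplication
    preserves the lengths of words. *)
Lemma sem_delta_mu x y : sem (Delta ∘ Mu) x y <->
  sem ((Mu ⊗ Mu) ∘ (Id 1 ⊗ P11 ⊗ Id 1) ∘ (Delta ⊗ Delta)) x y.
Proof.
split=> xy; have [] := sem_size xy; case: x xy => [|a [|b []]] //.
  move=> [z [_ [_ [[<- <-] ->]]] [u [v [_ [[<-] -> [wu uv vw]]]]]] _ _.
  have Du : size u = size (a ++ b).
    by move/(congr1 size): wu; rewrite !size_map.
  have Dv := size_unzip12 uv.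
  pose l := size a.
  have t1 : unzip1 a = unzip1 (take l u).
    rewrite /unzip1 map_take -/(unzip1 u) -wu /unzip1 map_cat.
    by rewrite take_size_cat ?size_map.
  have d1 : unzip1 b = unzip1 (drop l u).
    rewrite /unzip1 map_drop -/(unzip1 u) -wu /unzip1 map_cat.
    by rewrite drop_size_cat ?size_map.
  have t2 : unzip2 (take l v) = unzip2 a.
    rewrite /unzip2 map_take -/(unzip2 v) vw /unzip2 map_cat.
    by rewrite take_size_cat ?size_map.
  have d2 : unzip2 (drop l v) = unzip2 b.
    rewrite /unzip2 map_drop -/(unzip2 v) vw /unzip2 map_cat.
    by rewrite drop_size_cat ?size_map.
  have t3 : unzip2 (take l u) = unzip1 (take l v).
    by rewrite /unzip2 /unzip1 !map_take -/(unzip2 u) uv.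
  have d3 : unzip2 (drop l u) = unzip1 (drop l v).
    by rewrite /unzip2 /unzip1 !map_drop -/(unzip2 u) uv.
  exists [:: take l u; take l v; drop l u; drop l v].
    split; first by exists (take l u), (take l v), a.
    by exists (drop l u), (drop l v), b.
  exists [:: take l u; drop l u; take l v; drop l v]; first by [].
  split; first by exists (take l u), (drop l u); rewrite cat_take_drop.
  by exists (take l v), (drop l v); rewrite cat_take_drop.
move=> [z [[a1 [a2 [_ [[<-] ez [e1 e2 e3]]]]] [b1 [b2 [_ [[<-] ez' [e4 e5 e6]]]]]]].
have {ez ez'}-> : z = [:: a1; a2; b1; b2] by rewrite -[z](cat_take_drop 2) ez ez'.
move=> [z' [[[_ m1] [_ m2]] [_ m3]] [[u [v [y1 y1']]] [u' [v' [y2 y2']]]]] _ _.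
have Dz' : z' = [:: a1; b1; a2; b2].
  rewrite -[z'](cat_take_drop 3) m3 -[take 3 z'](cat_take_drop 1) m1.
  by rewrite [drop 1 (take 3 z')]m2.
move: y1 y2; rewrite Dz' => -[Du Dv] [Du' Dv']; subst u v u' v'.
have -> : y = [:: a1 ++ b1; a2 ++ b2] by rewrite -[y](cat_take_drop 1) y1' y2'.
exists [:: a ++ b]; first by exists a, b.
exists (a1 ++ b1), (a2 ++ b2), (a ++ b); split=> //.
by rewrite /unzip1 /unzip2 !map_cat; split; congr (_ ++ _).
Qed.

Lemma sem_delta_eta x y : sem (Delta ∘ Eta) x y <-> sem (Eta ⊗ Eta) x y.
Proof.
split=> [[z [-> ->] [u [v [_ [[<-] -> [wu uv _]]]]]] | [[x1 y1] [x2 y2]]].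
  by case: u wu uv => // _; case: v.
exists [:: [::]].
  by rewrite -[x](cat_take_drop 0) x1 x2.
by exists [::], [::], [::]; rewrite -[y](cat_take_drop 1) y1 y2.
Qed.

Lemma sem_eps_mu x y : sem (Eps ∘ Mu) x y <-> sem (Eps ⊗ Eps) x y.
Proof.
split=> [[z [u [v [-> ->]]] [_ [[<-] ->]]] | [[u [x1 y1] eu] [v [x2 y2] ev]]].
  rewrite /unzip1 /unzip2 !map_cat => /eqP; rewrite eqseq_cat ?size_map //.
  by case/andP=> /eqP eu /eqP ev; split; [exists u | exists v].
exists [:: u ++ v].
  by exists u, v; rewrite -[x](cat_take_drop 1) x1 x2.
exists (u ++ v); first by rewrite -[y](cat_take_drop 0) y1 y2.
by rewrite /unzip1 /unzip2 !map_cat -!/(unzip1 _) -!/(unzip2 _) eu ev.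
Qed.

Lemma sem_eps_eta x y : sem (Eps ∘ Eta) x y <-> sem (Id 0) x y.
Proof.
split=> [[z [-> ->] [w [_ ->]]] // | [/eqP + ->]].
by rewrite size_eq0 => /eqP ->; exists [:: [::]] => //; exists [::].
Qed.

Lemma sem_beq n m (f g : arrow n m) : f ≡ g -> forall x y, sem f x y <-> sem g x y.
Proof.
elim=> {n m f g}.
- by [].
- by move=> n m f g _ fg x y; rewrite fg.
- by move=> n m f g h _ fg _ gh x y; rewrite fg gh.
- move=> n m k g g' f f' _ gg' _ ff' x y /=.
  by split=> -[z /ff' xz /gg' zy]; exists z.
- by move=> n m n' m' f g f' g' _ fg _ fg' x y /=; rewrite fg fg'.
- move=> n m f x y /=; split=> [[z xz [_ ->]] // | xy].
  by exists y => //; case: (sem_size xy).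
- move=> n m f x y /=; split=> [[z [_ ->]] // | xy].
  by exists x => //; case: (sem_size xy).
- move=> n m k l h g f x y /=.
  split=> [[z [z' xz zz'] z'y] | [z xz [z' zz' z'y]]].
    by exists z' => //; exists z.
  by exists z' => //; exists z.
- move=> n m x y /=; split=> [[[Dn Ey] [Dm Ey']] | [Dx ->]].
    split; first exact: size_take_drop.
    by rewrite -(cat_take_drop n y) Ey Ey' cat_take_drop.
  by rewrite size_takel ?size_drop Dx ?leq_addr // addKn.
- move=> n m k n' m' k' g f g' f' x y /=; split.
    by case=> z [fz fz'] [gz gz']; split; [exists (take m z) | exists (drop m z)].
  case=> -[z fz gz] [z' fz' gz']; have [_ Dz] := sem_size fz.
  by exists (z ++ z'); rewrite take_size_cat // drop_size_cat.
- move=> n m n' m' n'' m'' f f' f'' x y; rewrite sem_cast /=.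
  rewrite !drop_drop !take_drop !take_takel ?leq_addr //.
  rewrite [n' + n]addnC [m' + m]addnC; tauto.
- move=> n m f x y /=; rewrite !take0 !drop0; split=> [[]//|xy]; by split.
- move=> n m f x y; rewrite sem_cast /=; split.
    case=> xy [Dx Ey]; have [Dn Dm] := sem_size xy.
    have {}Dx := size_take_drop Dn Dx; have Dy := congr1 size Ey.
    have {}Dy : size y = m + 0.
      by apply: size_take_drop; rewrite // Dy size_drop Dx addKn.
    by rewrite !take_oversize ?Dx ?Dy ?addn0 in xy.
  move=> xy; have [Dx Dy] := sem_size xy.
  by rewrite !take_oversize ?drop_oversize ?Dx ?Dy.
- move=> n m n' m' f f' x y /=; split.
    case=> z [fz fz'] [Dz ->].
    have [Dx Dt] := sem_size fz; have [Dx' Dt'] := sem_size fz'.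
    exists (drop n x ++ take n x).
      by split=> //; exact: size_take_drop.
    by rewrite !take_size_cat ?drop_size_cat.
  case=> z [Dx ->]; have Dn : size (drop n x) = n' by rewrite size_drop Dx addKn.
  rewrite take_size_cat // drop_size_cat // => -[fz' fz].
  have [_ Dt] := sem_size fz; have [_ Dt'] := sem_size fz'.
  exists (drop m' y ++ take m' y).
    by rewrite take_size_cat // drop_size_cat.
  split; first by rewrite size_cat Dt Dt'.
  by rewrite take_size_cat // drop_size_cat // cat_take_drop.
- move=> n m x y /=; split.
    case=> z [Dx ->] [_ ->]; split=> //.
    have Dm : size (drop n x) = m by rewrite size_drop Dx addKn.
    by rewrite take_size_cat // drop_size_cat // cat_take_drop.
  case=> Dx ->; have Dm : size (drop n x) = m by rewrite size_drop Dx addKn.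
  exists (drop n x ++ take n x) => //; split.
    by rewrite -/(rot n x) size_rot Dx addnC.
  by rewrite take_size_cat // drop_size_cat // cat_take_drop.
- exact: sem_hexagon.
- exact: sem_mu_assoc.
- exact: sem_mu_unitr.
- exact: sem_mu_unitl.
- exact: sem_delta_coassoc.
- exact: sem_delta_counitr.
- exact: sem_delta_counitl.
- exact: sem_delta_mu.
- exact: sem_delta_eta.
- exact: sem_eps_mu.
- exact: sem_eps_eta.
Qed.

(** * Recovering a factorization from its relation *)

Lemma sem_heq n m n' m' (f : arrow n m) (g : arrow n' m') x y :
  f ≈ g -> sem f x y <-> sem g x y.
Proof.
by case=> en [em]; subst n' m'; rewrite cast_id => /sem_beq.
Qed.

Lemma sem_mu_iter k x y :
  sem (mu_iter k) x y <-> size x = k /\ y = [:: flatten x].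
Proof.
elim: k x y => [|k IHk] x y.
  by split=> [[-> ->] // | [/eqP + ->]]; rewrite size_eq0 => /eqP ->.
rewrite (sem_heq _ _ (mu_iterS k)) /=; split.
  move=> [z [/IHk[Dk z1] [D1 z2]] [u [v [Dz ->]]]]; split.
    by rewrite (size_take_drop Dk D1) addn1.
  rewrite -(cat_take_drop k x) flatten_cat.
  move: z1 z2; rewrite Dz /= => -[->] <-; congr [:: _ ++ _].
  by rewrite /= cats0.
case=> Dx ->; have lek : k <= size x by rewrite Dx.
exists [:: flatten (take k x); flatten (drop k x)].
  split; first by apply/IHk; rewrite size_takel.
  have : size (drop k x) = 1 by rewrite size_drop Dx subSnn.
  by case: (drop k x) => [|w []] //= _; rewrite cats0.
exists (flatten (take k x)), (flatten (drop k x)).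
by rewrite -flatten_cat cat_take_drop.
Qed.

Lemma sem_mu_tens q x y :
  sem (mu_tens q) x y <-> size x = sumn q /\ y = map flatten (reshape q x).
Proof.
elim: q x y => [|k q IHq] x y /=.
  by split=> [[/eqP + ->] | [/eqP + ->]]; rewrite size_eq0 => /eqP ->.
rewrite sem_mu_iter IHq; split.
  move=> [[Dk y1] [Dq y2]]; split; first exact: size_take_drop.
  by rewrite -[y](cat_take_drop 1) y1 y2.
case=> Dx -> /=; rewrite take0 drop0 size_takel ?Dx ?leq_addr //.
by rewrite size_drop Dx addKn.
Qed.

Definition edge k : word := [:: (k, k.+1)].

Lemma edgesSr a k : [seq edge i | i <- iota a k.+1] =
  [seq edge i | i <- iota a k] ++ [:: edge (a + k)].
Proof. by rewrite -addn1 iotaD map_cat. Qed.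

Lemma sem_delta_iter_edges k a :
  sem (delta_iter k) [:: [:: (a, a + k)]] [seq edge i | i <- iota a k].
Proof.
elim: k => [|k IHk]; first by exists [:: (a, a + 0)]; rewrite /= ?addn0.
rewrite (sem_heq _ _ (delta_iterS k)) edgesSr /=.
exists [:: [:: (a, a + k)]; edge (a + k)].
  exists [:: (a, a + k)], (edge (a + k)), [:: (a, a + k.+1)].
  by rewrite /= addnS.
by rewrite /= take_size_cat ?drop_size_cat ?size_map ?size_iota.
Qed.

(** Among all the paths of length [k] from [a] to [b], only one consists of
    steps by 1, and it forces [b = a + k]. *)
Lemma delta_iter_edges_inv k a b y :
    sem (delta_iter k) [:: [:: (a, b)]] y ->
    (forall w, w \in y -> exists i, w = edge i) ->
  b = a + k /\ y = [seq edge i | i <- iota a k].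
Proof.
elim: k b y => [|k IHk] b y.
  by case=> w [[<-] ->] [<-] _; rewrite addn0.
rewrite edgesSr (sem_heq _ _ (delta_iterS k)) => -[z [u [v [w [[<-] ->]]]]] /=.
move=> [wu uv vw] [uy [_ yv]] edges.
have [c Dv] : exists c, v = edge c.
  by apply: edges; rewrite -(cat_take_drop k y) yv mem_cat mem_seq1 eqxx orbT.
subst v; case: u wu uv uy => [|[a' c'] []] //= [<-] [->] uy.
have [|Dc Dy] := IHk _ _ uy.
  by move=> w' /mem_take; exact: edges.
case: vw => <-; rewrite Dc addnS; split=> //.
by rewrite -(cat_take_drop k y) Dy yv Dc.
Qed.

Notation letters := (all (fun w : word => size w == 1)).

Lemma delta_tens_letters p x y : sem (delta_tens p) x y ->
  letters x -> letters y.
Proof.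
have iter k x' y' : sem (delta_iter k) x' y' ->
    letters x' -> letters y'.
  elim: k x' y' => [|k IHk] x' y'; first by case=> w [_ ->].
  rewrite (sem_heq _ _ (delta_iterS k)) => -[z [u [v [w [-> ->]]]]] /=.
  move=> [wu uv _] [uy [_ yv]]; rewrite andbT => w1.
  have {w1}u1 : size u == 1 by move/(congr1 size): wu; rewrite !size_map => <-.
  rewrite -(cat_take_drop k y') all_cat yv /= andbT -(size_unzip12 uv) u1 andbT.
  by apply: IHk uy _; rewrite /= u1.
elim: p x y => [|k p IHp] x y /=; first by case=> _ ->.
move=> [xy xy']; rewrite -{1}(cat_take_drop 1 x) -(cat_take_drop k y) !all_cat.
by case/andP=> /(iter _ _ _ xy) -> /(IHp _ _ xy').
Qed.

(** The letters joining the ends of the consecutive paths, of lengths [p], into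
    which the chain from [a] to [a + sumn p] is cut. *)
Fixpoint path_ends a p : seq word :=
  if p is k :: p' then [:: (a, a + k)] :: path_ends (a + k) p' else [::].

Lemma path_ends_letters a p : letters (path_ends a p).
Proof. by elim: p a => //= k p IHp a; rewrite IHp. Qed.

Lemma sem_delta_tens_edges a p :
  sem (delta_tens p) (path_ends a p) [seq edge i | i <- iota a (sumn p)].
Proof.
elim: p a => [|k p IHp] a //=.
rewrite take0 drop0 iotaD map_cat take_size_cat ?drop_size_cat ?size_map ?size_iota //.
by split; [exact: sem_delta_iter_edges | exact: IHp].
Qed.

Lemma delta_tens_edges_inv a p p' y :
    size p = size p' -> sem (delta_tens p') (path_ends a p) y ->
    (forall w, w \in y -> exists i, w = edge i) ->
  p = p' /\ y = [seq edge i | i <- iota a (sumn p)].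
Proof.
elim: p p' a y => [|k p IHp] [|k' p'] //=; first by move=> a y _ [_ ->].
move=> a y [Dp].
rewrite take0 drop0 => -[/delta_iter_edges_inv xy xy'] edges.
have [|/addnI Dk y1] := xy; first by move=> w /mem_take; exact: edges.
subst k'; have [|-> y2] := IHp _ _ _ Dp xy'; first by move=> w /mem_drop; exact: edges.
by split=> //; rewrite -(cat_take_drop k y) y1 y2 iotaD map_cat.
Qed.

Lemma sem_adj s (i : 'I_s.-1) l u v r y :
    size l = i -> size r = s - i - 2 ->
  sem (adj_arrow i) (l ++ u :: v :: r) y <-> y = l ++ v :: u :: r.
Proof.
move=> Dl Dr; rewrite /adj_arrow sem_cast /=.
rewrite take_size_cat // drop_size_cat //=; split.
  move=> [[_ y1] [[_ y2] [_ y3]]].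
  by rewrite -[LHS](cat_take_drop i) y1 -[drop i y](cat_take_drop 2) y2 y3 take0 drop0.
by move=> ->; rewrite take_size_cat // drop_size_cat //= !drop0 !take0.
Qed.

Lemma split_adj s (i : 'I_s.-1) (x : seq word) : size x = s ->
  exists l u v r, [/\ x = l ++ u :: v :: r, size l = i & size r = s - i - 2].
Proof.
move=> Dx; have lti := ltn_ord i.
exists (take i x), (nth [::] x i), (nth [::] x i.+1), (drop i.+2 x); split.
- by rewrite -!drop_nth ?cat_take_drop // Dx; lia.
- by rewrite size_takel // Dx; lia.
- by rewrite size_drop Dx; lia.
Qed.

Lemma sem_adj_nth s (i : 'I_s.-1) x y : sem (adj_arrow i) x y ->
  forall j : 'I_s, nth [::] y (adj_perm i j) = nth [::] x j.
Proof.
move=> xy j; have [Dx _] := sem_size xy.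
have [l [u [v [r [Ex Dl Dr]]]]] := split_adj i Dx.
move: xy; rewrite Ex sem_adj // => ->; rewrite /adj_perm.
case: tpermP => [-> | -> | /eqP + /eqP] /=.
- by rewrite !nth_cat Dl ltnn subnn ltnNge leqnSn /= subSnn.
- by rewrite !nth_cat Dl ltnn subnn ltnNge leqnSn /= subSnn.
rewrite -!val_eqE /= !nth_cat Dl => ji ji1; case: ltnP => // leij.
by have -> : j - i = (j - i - 2).+2 by lia.
Qed.

Lemma sem_perm_nth s (x : 'S_s) u v : sem (perm_arrow x) u v ->
  forall j : 'I_s, nth [::] v (x j) = nth [::] u j.
Proof.
rewrite /perm_arrow; set w := xchoose _.
rewrite (eqP (xchooseP (adj_generate x)) : x = word_perm w).
elim: w u => [|i w IHw] u /=.
  by case=> _ -> j; rewrite /word_perm big_nil perm1.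
move=> [z uz /IHw zv] j.
by rewrite /word_perm big_cons permM zv; exact: sem_adj_nth uz j.
Qed.

Lemma sem_perm_total s (x : 'S_s) u : size u = s -> exists v, sem (perm_arrow x) u v.
Proof.
rewrite /perm_arrow; elim: (xchoose _) u => [|i w IHw] u Du /=; first by exists u.
have [l [a [b [r [-> Dl Dr]]]]] := split_adj i Du.
have adj : sem (adj_arrow i) (l ++ a :: b :: r) (l ++ b :: a :: r) by apply/sem_adj.
have [v zv] := IHw _ (sem_size adj).2.
by exists v; exists (l ++ b :: a :: r).
Qed.

Lemma sem_fact n m (d : factorization n m) x y : sem (fact_arrow d) x y <->
  exists u v, [/\ sem (delta_tens (fact_p d)) x u, sem (perm_arrow (fact_perm d)) u v &
     sem (mu_tens (fact_q d)) v y].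
Proof.
rewrite /fact_arrow sem_cast /=; split.
  by move=> [u xu [v]]; rewrite sem_cast => uv vy; exists u, v.
by move=> [u [v [xu uv vy]]]; exists u => //; exists v; rewrite ?sem_cast.
Qed.

Lemma letters_flatten (x : seq word) :
  letters x -> x = [seq [:: c] | c <- flatten x].
Proof. by elim: x => //= -[|c []] //= x IHx /IHx <-. Qed.

(** When all the inputs of [mu_tens q] have length 1, its outputs have lengths
    [q]; this is how [q] is read off the relation. *)
Lemma shape_letters q (x : seq word) : size x = sumn q ->
  letters x -> shape (map flatten (reshape q x)) = q.
Proof.
elim: q x => //= k q IHq x Dx; rewrite -{1}(cat_take_drop k x) all_cat.
case/andP=> x1 x2; rewrite IHq ?size_drop ?Dx ?addKn //; congr (_ :: _).
have := congr1 size (letters_flatten x1).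
by rewrite size_map size_takel // Dx leq_addr.
Qed.

Lemma sem_perm_mem s (x : 'S_s) u v : sem (perm_arrow x) u v -> u =i v.
Proof.
move=> uv w; have [Du Dv] := sem_size uv; have uvx := sem_perm_nth uv.
apply/(nthP [::])/(nthP [::]) => -[i lti <-].
  rewrite Du in lti; exists (x (Ordinal lti)); last exact: uvx.
  by rewrite Dv.
rewrite Dv in lti; exists (x^-1 (Ordinal lti))%g; last by rewrite -uvx permKV.
by rewrite Du.
Qed.

(** The permutation is determined by its effect on one list without
    repetitions. *)
Lemma sem_perm_inj s (x x' : 'S_s) u v : uniq u ->
  sem (perm_arrow x) u v -> sem (perm_arrow x') u v -> x = x'.
Proof.
move=> Uu uv uv'; have [Du _] := sem_size uv.
apply/permP => j; apply: (canRL (permKV x')); apply/val_inj/eqP => /=.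
rewrite -(nth_uniq [::] _ _ Uu) ?Du //.
by rewrite -(sem_perm_nth uv') permKV (sem_perm_nth uv).
Qed.

Lemma factorization_unique n m (d d' : factorization n m) :
  fact_arrow d ≡ fact_arrow d' -> d = d'.
Proof.
move/sem_beq => dd'.
pose x := path_ends 0 (fact_p d).
pose u := [seq edge i | i <- iota 0 (sumn (fact_p d))].
have xu : sem (delta_tens (fact_p d)) x u by exact: sem_delta_tens_edges.
have Du : size u = sumn (fact_p d) by rewrite size_map size_iota.
have [v uv] := sem_perm_total (fact_perm d) Du.
have [_ Dv] := sem_size uv.
have vy : sem (mu_tens (fact_q d)) v (map flatten (reshape (fact_q d) v)).
  by apply/sem_mu_tens; rewrite Dv (fact_sum d).
set y := map _ _ in vy.
have /dd'/sem_fact[u' [v' [xu' uv' vy']]] : sem (fact_arrow d) x y.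
  by apply/sem_fact; exists u, v.
have x1 : letters x by exact: path_ends_letters.
have v1 : letters v.
  by rewrite -(eq_all_r (sem_perm_mem uv)); exact: delta_tens_letters xu x1.
have v1' : letters v'.
  by rewrite -(eq_all_r (sem_perm_mem uv')); exact: delta_tens_letters xu' x1.
have [/sem_mu_tens[Dv2 _] /sem_mu_tens[Dv2' Dy]] := (vy, vy').
have Dq : fact_q d = fact_q d' :> seq nat.
  by rewrite -(shape_letters Dv2 v1) -(shape_letters Dv2' v1') -Dy.
have fl q (z : seq word) : size z = sumn q ->
    flatten (map flatten (reshape q z)) = flatten z.
  move=> Dz; rewrite -[z in RHS](reshapeKr (sh := q)) ?Dz //.
  by elim: (reshape q z) => //= a b ->; rewrite flatten_cat.
have Dvv : v = v'.
  rewrite (letters_flatten v1) (letters_flatten v1').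
  by rewrite -(fl _ _ Dv2) -(fl _ _ Dv2') -Dy.
(* All words in [u'] are edges, because those in [u] are and permutations
   preserve the set of words; so the path inversion applies to [u']. *)
have edges w : w \in u' -> exists i, w = edge i.
  by rewrite (sem_perm_mem uv') -Dvv -(sem_perm_mem uv) => /mapP[i _ ->]; exists i.
have [|Dp Du'] := delta_tens_edges_inv _ xu' edges; first by rewrite !size_tuple.
move: uv uv'; rewrite -Dvv Du' -/u; have Uu : uniq u.
  by rewrite map_inj_uniq ?iota_uniq // => i j [].
clear -Dp Dq Uu; move: Dp Dq Uu; rewrite {}/u.
case: d => [p q Ds x]; case: d' => [p' q' Ds' x'] /= Dp Dq.
move/val_inj: Dp => Dp; move/val_inj: Dq => Dq; subst p' q'.
rewrite (eq_irrelevance Ds' Ds) => Uu uv uv'; congr Factorization.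
exact: sem_perm_inj Uu uv uv'.
Qed.

Theorem theorem1p1 (n m : nat) (f : arrow n m) :
  exists! d : factorization n m, f ≡ fact_arrow d.
Proof.
have [d fd] := factorization_exists f; exists d; split=> // d' fd'.
exact: factorization_unique (beq_trans (beq_sym fd) fd').
Qed.
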